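(* Let $X$ be a noncompact, locally compact, separable metrizable space. Then for each $n\in\mathbb Z$ with $n\ge 0$ there exists a totally bounded metric $d_n$ compatible with the topology on $X$ such that $\dim(u_{d_n}X\setminus X)=\operatorname{ind}(u_{d_n}X\setminus X)=\operatorname{Ind}(u_{d_n}X\setminus X)=n$.
   Context: A metric $d$ on $X$ is totally bounded if $(X,d)$ is a totally bounded metric space. Compactifications are Hausdorff. For a metric space $(X,d)$, let $U_d^*(X)$ be the set of all bounded uniformly continuous functions $X\to\mathbb R$. The Smirnov compactification $u_dX$ of $(X,d)$ is the compactification of $X$ associated with the closed subring $U_d^*(X)$ of $C^*(X)$ (the Banach algebra of bounded continuous real-valued functions with the sup-norm); concretely, it is the closure of $e(X)$ in $\prod_{f\in U_d^*(X)}[\inf f(X),\sup f(X)]$, where $e(x)=(f(x))_{f}$ is the evaluation map, and $X$ is identified with $e(X)$. $\dim$ is the covering dimension, $\operatorname{ind}$ the small inductive dimension and $\operatorname{Ind}$ the large inductive dimension. For a normal space $Y$: $\operatorname{Ind}Y=-1$ iff $Y=\emptyset$; for $n\ge 0$, $\operatorname{Ind}Y\le n$ iff for every pair $A,B$ of disjoint closed subsets of $Y$ there is a partition $L$ between $A$ and $B$ (a closed set $L\subset Y$ for which there are disjoint open sets $U\supset A$, $V\supset B$ with $Y\setminus L=U\cup V$) such that $\operatorname{Ind}L\le n-1$. $\operatorname{ind}$ is defined in the same way with $A$ restricted to be a single point. *)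

(* Defs.v *)
From HB Require Import structures.
From mathcomp Require Import all_boot all_order all_algebra.
From mathcomp Require Import all_classical all_reals all_analysis.

Set Implicit Arguments.
Unset Strict Implicit.
Unset Printing Implicit Defensive.

Import Order.TTheory GRing.Theory Num.Theory.
Import numFieldNormedType.Exports.

Local Open Scope classical_set_scope.
Local Open Scope ring_scope.

(* Nonnegativity of [d] follows from the three axioms. *)
Record is_metric (R : realType) (T : Type) (d : T -> T -> R) : Prop := IsMetric {
  metric_eq0 : forall x y, d x y = 0 <-> x = y ;
  metric_symm : forall x y, d x y = d y x ;
  metric_tri : forall x y z, d x z <= d x y + d y z
}.

(* The metric space (T, d), as an alias of T: when T already carries a
   topology, that topology is forgotten in favour of the one given by d. *)
Definition metrized (R : realType) (T : choiceType) (d : T -> T -> R)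
  (dm : is_metric d) : Type := T.

Section metrized_metric.
Context {R : realType} {T : choiceType} {d : T -> T -> R} (dm : is_metric d).

Let metrized_dxx (x : metrized dm) : d x x = 0.
Proof. by apply/(metric_eq0 dm). Qed.

Let metrized_d0 (x y : metrized dm) : d x y = 0 -> x = y.
Proof. by move/(metric_eq0 dm). Qed.

Let metrized_tri (y x z : metrized dm) : d x z <= d x y + d y z.
Proof. exact: (metric_tri dm). Qed.

HB.instance Definition _ := Choice.copy (metrized dm) T.
HB.instance Definition _ := @isMetric.Build R (metrized dm) d
  metrized_dxx metrized_d0 (metric_symm dm) metrized_tri.

End metrized_metric.

Definition compatible_metric (R : realType) (X : topologicalType)
    (d : X -> X -> R) (dm : is_metric d) : Prop :=
  forall A : set X, open A <-> open (A : set (metrized dm)).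

Definition metrizable (R : realType) (X : topologicalType) : Prop :=
  exists (d : X -> X -> R) (dm : is_metric d), compatible_metric dm.

Definition separable (X : topologicalType) : Prop :=
  exists2 D : set X, countable D & dense D.

Definition totally_bounded (R : realType) (M : metricType R) : Prop :=
  forall e : R, 0 < e ->
    exists2 F : set M, finite_set F & [set: M] `<=` \bigcup_(x in F) ball x e.

Section smirnov.
Context {R : realType} (M : metricType R).

Definition bounded_unif_continuous : set (M -> R) :=
  [set f | bounded_fun f /\ unif_continuous f].

Definition range_hull (f : M -> R) : set R :=
  `[inf (range f), sup (range f)]%classic.

Definition smirnov_cube : topologicalType :=
  prod_topology (fun f : bounded_unif_continuous => range_hull (\val f)).

Lemma range_hull_val (f : bounded_unif_continuous) (x : M) :
  range_hull (\val f) (\val f x).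
Proof.
have [bf _] := set_valP f; rewrite /range_hull /= in_itv /=; apply/andP; split.
- by apply: ge_inf; [exact: bounded_fun_has_lbound | exists x].
- by apply: ub_le_sup; [exact: bounded_fun_has_ubound | exists x].
Qed.

Definition smirnov_eval (x : M) : smirnov_cube :=
  fun f => SigSub (mem_set (range_hull_val f x)).

Definition smirnov_compactification : set smirnov_cube :=
  closure (range smirnov_eval).

Definition smirnov_remainder : set smirnov_cube :=
  smirnov_compactification `\` range smirnov_eval.

End smirnov.

Arguments bounded_unif_continuous {R} M.
Arguments smirnov_cube {R} M.
Arguments smirnov_eval {R} M x.
Arguments smirnov_compactification {R} M.
Arguments smirnov_remainder {R} M.

Definition partition_between (Y : topologicalType) (A B L : set Y) : Prop :=
  closed L /\ exists U V : set Y,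
    [/\ open U /\ open V, A `<=` U, B `<=` V, U `&` V = set0 & ~` L = U `|` V].

(* The dimensions take values in {-1, 0, 1, ..., +oo}; to index by nat, the
   predicates below express "the dimension of Y is < n", so that n = 0 is the
   case of dimension -1 and n.+1 that of dimension <= n. Subsets of a space are
   coerced to spaces with the subspace topology. *)
Fixpoint small_ind_lt (n : nat) (Y : topologicalType) : Prop :=
  if n is m.+1 then
    forall (x : Y) (B : set Y), closed B -> ~ B x ->
      exists2 L : set Y, partition_between [set x] B L & small_ind_lt m L
  else [set: Y] = set0.

Fixpoint large_ind_lt (n : nat) (Y : topologicalType) : Prop :=
  if n is m.+1 then
    forall A B : set Y, closed A -> closed B -> A `&` B = set0 ->
      exists2 L : set Y, partition_between A B L & large_ind_lt m L
  else [set: Y] = set0.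

Definition finite_open_cover (Y : topologicalType) (C : set (set Y)) : Prop :=
  [/\ finite_set C, C `<=` open & \bigcup_(A in C) A = [set: Y]].

Definition refines (Y : Type) (D C : set (set Y)) : Prop :=
  forall V, D V -> exists2 U, C U & V `<=` U.

(* dim Y <= n iff every finite open cover has a finite open refinement of order
   <= n, i.e. such that no point lies in more than n + 1 members; for n = 0
   below, this says that Y is empty. *)
Definition covering_dim_lt (n : nat) (Y : topologicalType) : Prop :=
  forall C : set (set Y), finite_open_cover C ->
    exists D : set (set Y), [/\ finite_open_cover D, refines D C &
      forall y : Y, ([set V | D V /\ V y] #<= `I_n)%card].

Definition dimension_eq (dim_lt : nat -> topologicalType -> Prop)
    (Y : topologicalType) (n : nat) : Prop :=
  dim_lt n.+1 Y /\ ~ dim_lt n Y.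

(* Main.v *)
Require Import Defs.
From mathcomp Require Import all_boot all_order all_algebra.
From mathcomp Require Import fingroup perm.
From mathcomp Require Import all_classical all_reals all_analysis.
From mathcomp Require Import zify ring lra.

Set Implicit Arguments.
Unset Strict Implicit.
Unset Printing Implicit Defensive.

Import Order.TTheory GRing.Theory Num.Theory.
Import numFieldNormedType.Exports.

Local Open Scope classical_set_scope.
Local Open Scope ring_scope.

(** The remainder is made to be the cube [[0, 1]^n], and the three dimensions of
    the cube are computed.

    Let [rho] be a compatible metric on [X]. There is a function [h > 0] on [X],
    nonexpansive for [rho], whose superlevel sets [{h >= e}] are compact
    ([height_function]), and a continuous map [f] from [X] to the cube such that
    [f({h < e})] is dense for every [e > 0] ([dense_map]). The metric is
      [d(x, y) = min (rho(x, y), h(x) + h(y)) + sum_i |f_i(x) - f_i(y)|];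
    it is the sum of the metric of the one-point compactification and of the
    pseudometric induced by [f]. Near infinity [d] is controlled by [f] alone,
    so that [d] is totally bounded, and every uniformly continuous function is
    asymptotically a function of [f]: the coordinates [f_i] extend to a
    continuous bijection from the remainder onto the cube
    ([graph_dist_remainder]), while the extension of [h] vanishes exactly on the
    remainder, which is therefore compact.

    For a compact Hausdorff space, dim <= ind <= Ind. The second inequality is
    immediate since points are closed ([large_ind_small_ind]). For the first
    one ([small_ind_shrinkable]), a finite cover is refined by finitely many
    open sets with boundaries of smaller small inductive dimension; disjointing
    these sets covers everything but their boundaries, and by the finite closed
    sum theorem for dim the union of the boundaries is covered by a family of
    order one less. It thus remains to prove that the cube has Ind <= n and
    dim >= n. The upper bound ([large_ind_lt_grid]) uses partitions contained in
    the walls of a fine grid, each of which restricts one more coordinate to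
    finitely many values. The lower bound ([cube_not_shrinkable]) is the
    Lebesgue covering theorem, deduced from Sperner's lemma for the Kuhn
    triangulation of a cubical grid ([cubical_sperner]), which is proved by
    counting facets modulo 2. *)

(** * Sperner's lemma on cubical grids *)

Section combinatorics.
Local Open Scope nat_scope.

(** The labels [0, ..., k] all occur among the vertices [0, ..., k]; a label
    function gives the label [L b] of the vertex of index [b]. *)
Definition full_labels (k : nat) (L : nat -> nat) : bool :=
  [forall a : 'I_k.+1, [exists b : 'I_k.+1, L b == a]].

(** The labels [0, ..., k.-1] all occur on the facet opposite to the vertex of
    index [j] of a simplex with vertices [0, ..., k]. *)
Definition facet_labels (k j : nat) (L : nat -> nat) : bool :=
  [forall a : 'I_k, [exists b : 'I_k.+1, (b != j :> nat) && (L b == a)]].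

Lemma full_labelsP k L :
  reflect (forall a, a <= k -> exists2 b, b <= k & L b = a) (full_labels k L).
Proof.
apply: (iffP forallP) => [h a ak|h a].
  have /existsP[b /eqP Lb] := h (Ordinal (ak : a < k.+1)).
  by exists b => //; rewrite -ltnS.
have [|b bk Lb] := h a; first by rewrite -ltnS.
by apply/existsP; exists (Ordinal (bk : b < k.+1)); apply/eqP.
Qed.

Lemma facet_labelsP k j L :
  reflect (forall a, a < k -> exists b, [/\ b <= k, b <> j & L b = a])
    (facet_labels k j L).
Proof.
apply: (iffP forallP) => [h a ak|h a].
  have /existsP[b /andP[/eqP bj /eqP Lb]] := h (Ordinal ak).
  by exists b; split => //; rewrite -ltnS.
have [|b [bk bj Lb]] := h a; first exact: ltn_ord.
apply/existsP; exists (Ordinal (bk : b < k.+1)).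
by apply/andP; split; apply/eqP.
Qed.

Lemma facet_labels_last k L : facet_labels k.+1 k.+1 L = full_labels k L.
Proof.
apply/facet_labelsP/full_labelsP => h a ak.
  have [|b [bk bk1 Lb]] := h a; first by lia.
  by exists b => //; lia.
have [|b bk Lb] := h a; first by lia.
by exists b; split => //; lia.
Qed.

(** A simplex with labels at most [k] is fully labelled if and only if it has
    an odd number of facets carrying all the labels below [k]. *)
Lemma facet_labels_parity (k : nat) (L : nat -> nat) :
  (forall b, b <= k -> L b <= k) ->
  \big[addb/false]_(j < k.+1) facet_labels k j L = full_labels k L.
Proof.
move=> Lk.
have [/full_labelsP hf|/full_labelsP nf] := boolP (full_labels k L).
  (* The labelling is a permutation: only the facet opposite to the vertex
     with label k carries all the smaller labels. *)
  pose F (b : 'I_k.+1) : 'I_k.+1 := inord (L b).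
  have FE b : F b = L b :> nat.
    by rewrite inordK // ltnS; apply: Lk; rewrite -ltnS.
  have F_inj : injective F.
    suff /image_injP h : #|fintype.image F predT| == #|{: 'I_k.+1}|.
      by move=> x y; exact: h.
    apply/eqP/eq_card => a; rewrite inE; apply/fintype.imageP.
    have [|b bk Lb] := hf a; first by rewrite -ltnS.
    exists (Ordinal (bk : b < k.+1)) => //.
    by apply/ord_inj; rewrite FE.
  have [j0 j0k Lj0] := hf k (leqnn k).
  rewrite (bigD1 (Ordinal (j0k : j0 < k.+1))) //= big1 ?addbF.
    apply/facet_labelsP => a ak; have [|b bk Lb] := hf a; first exact: ltnW.
    by exists b; split => //= bj; move: Lb; rewrite bj Lj0; lia.
  move=> j jj0; apply/negbTE/facet_labelsP => /(_ (L j)) [].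
    have : L j <= k by apply: Lk; rewrite -ltnS.
    rewrite leq_eqVlt => /orP[/eqP Ljk|//]; case/eqP: jj0.
    by apply: F_inj; apply/ord_inj; rewrite !FE /= Ljk Lj0.
  move=> b [bk bj Lb]; apply: bj.
  have -> : b = Ordinal (bk : b < k.+1) by [].
  by congr nat_of_ord; apply: F_inj; apply/ord_inj; rewrite !FE.
have [hs|hs] :=
    pselect (forall a, a < k -> exists2 b, b <= k & L b = a); last first.
  apply: big1 => j _; apply/negbTE/facet_labelsP => h; apply: hs.
  by move=> a /h[b [bk _ Lb]]; exists b.
(* Only the label k is missing: exactly two vertices share a label, and the good
   facets are the two facets opposite to them. *)
have Lk' b : b <= k -> L b < k.
  move=> bk; rewrite ltn_neqAle Lk // andbT; apply/eqP => Lbk; apply: nf => a.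
  by rewrite leq_eqVlt => /orP[/eqP ->|/hs//]; exists b.
have [b1 [b2 [b12 L12]]] : exists b1 b2 : 'I_k.+1, b1 != b2 /\ L b1 = L b2.
  case: k {hs nf} Lk Lk' => [|k] Lk Lk'; first by have := Lk' 0 isT.
  pose F (b : 'I_k.+2) : 'I_k.+1 := inord (L b).
  have /injectivePn[b1 [b2 b12 F12]] : ~~ injectiveb F.
    apply/negP => /injectiveP /leq_card; rewrite !card_ord; lia.
  exists b1, b2; split => //; have /(congr1 val) := F12.
  by rewrite /F /= !inordK //; apply: Lk'; rewrite -ltnS.
have good (c d : 'I_k.+1) : c != d -> L c = L d -> facet_labels k c L.
  move=> cd Lcd; apply/facet_labelsP => a /hs[b bk Lb].
  have [bc|bc] := eqVneq b c; last by exists b; split => //; apply/eqP.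
  exists d; split; [by rewrite -ltnS|by apply/eqP; rewrite eq_sym|].
  by rewrite -Lcd -bc.
rewrite (bigD1 b1) //= (bigD1 b2) 1?eq_sym //=.
rewrite (good b1 b2) // (good b2 b1) 1?eq_sym //.
rewrite big1 // => j /andP[jb1 jb2]; apply/negbTE/facet_labelsP => h.
have /all_sig2[F FP Fj] : forall a : 'I_k,
    {b : 'I_k.+1 | L b = a & [/\ b != j & b != b1]}.
  move=> a; apply: cid2; have [b [bk bj Lb]] := h a (ltn_ord a).
  have [bb1|bb1] := eqVneq b b1.
    exists b2; first by rewrite -L12 -bb1.
    by split; rewrite eq_sym.
  exists (Ordinal (bk : b < k.+1)) => //; split; apply/eqP => /(congr1 val) //=.
  exact/eqP.
have F_inj : injective F by move=> a b Fab; apply/val_inj; rewrite /= -!FP Fab.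
have : #|~: [set j; b1]%SET| < k.
  by have := cardsC [set j; b1]%SET; rewrite cards2 jb1 card_ord; lia.
rewrite ltnNge => /negP; apply; rewrite -{1}(card_ord k) -(card_codom F_inj).
apply/subset_leq_card/fintype.subsetP => _ /codomP[a ->].
by have [/negbTE aj /negbTE ab1] := Fj a; rewrite !inE aj ab1.
Qed.

(** A simplex of the Kuhn triangulation of the cubical grid with coordinates in
    [0, ..., m]: the lowest vertex [s.1] and the order in which the coordinates
    are increased by one, the coordinate [i] being increased at step [s.2 i]
    (steps are numbered from 0). *)
Definition kuhn_simplex (n m : nat) : finType :=
  ({ffun 'I_n -> 'I_m} * {perm 'I_n})%type.

(** The vertex of [s] reached after the first [j] steps. *)
Definition kuhn_vertex (n m : nat) (s : kuhn_simplex n m) (j : nat) :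
    'I_n -> nat :=
  fun i => s.1 i + (s.2 i < j).

(** The [k]-dimensional simplices of the face spanned by the first [k]
    coordinates: their other coordinates vanish at the vertices of index at most
    [k], and the steps from [k] on, which are in a fixed order, are ignored. *)
Definition kuhn_face (n m : nat) (k : nat) : pred (kuhn_simplex n m) :=
  fun s => [forall i : 'I_n, (k <= i) ==> (s.1 i == 0 :> nat) && (s.2 i == i)].

Lemma kuhn_faceP n m k (s : kuhn_simplex n m) :
  reflect (forall i : 'I_n, k <= i -> s.1 i = 0 :> nat /\ s.2 i = i)
    (kuhn_face k s).
Proof.
apply: (iffP forallP) => h i.
  by move=> ki; have := h i; rewrite ki /= => /andP[/eqP ? /eqP].
by apply/implyP => /h[-> ->]; rewrite !eqxx.
Qed.

Lemma kuhn_face_perm_lt n m k (s : kuhn_simplex n m) (i : 'I_n) :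
  kuhn_face k s -> (s.2 i < k) = (i < k).
Proof.
move=> /kuhn_faceP fs; have [ki|ik] := leqP k i.
  by have [_ ->] := fs _ ki; rewrite ltnNge ki.
apply/negP => /negP; rewrite -leqNgt => ki.
by have [_ /perm_inj si] := fs _ ki; rewrite si leqNgt ik in ki.
Qed.

(** Exchanging two consecutive steps changes exactly one vertex, so that the
    opposite facet belongs to exactly two simplices. *)
Definition kuhn_swap n m (a b : 'I_n) (s : kuhn_simplex n m) :
    kuhn_simplex n m :=
  (s.1, (s.2 * tperm a b)%g).

Lemma kuhn_swap_inj n m (a b : 'I_n) : injective (@kuhn_swap n m a b).
Proof. by move=> [v t] [v' t'] [-> /mulIg ->]. Qed.

Lemma kuhn_swap_vertex n m (a b : 'I_n) (s : kuhn_simplex n m) (j : nat) :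
  b = a.+1 :> nat -> j <> b :> nat ->
  kuhn_vertex (kuhn_swap a b s) j = kuhn_vertex s j.
Proof.
move=> ba jb; apply/funext => i; rewrite /kuhn_vertex /= permM.
by case: tpermP => [->|->|//]; congr (_ + nat_of_bool _); apply/idP/idP; lia.
Qed.

Lemma kuhn_swap_face n m k (a b : 'I_n) (s : kuhn_simplex n m) :
  a < k -> b < k -> kuhn_face k s -> kuhn_face k (kuhn_swap a b s).
Proof.
move=> ak bk /kuhn_faceP fs; apply/kuhn_faceP => i ki; have [v0 ti] := fs i ki.
split=> //=; rewrite permM ti; apply: tpermD; apply/eqP => e.
  by rewrite -e leqNgt ak in ki.
by rewrite -e leqNgt bk in ki.
Qed.

Lemma kuhn_swapK n m (a b : 'I_n) : involutive (@kuhn_swap n m a b).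
Proof. by move=> [v t]; rewrite /kuhn_swap /= -mulgA tperm2 mulg1. Qed.

Lemma facet_labels_eq k j L L' : (forall b, b <> j -> L b = L' b) ->
  facet_labels k j L = facet_labels k j L'.
Proof.
move=> LL'; apply/facet_labelsP/facet_labelsP => h a /h[b [bk bj <-]];
  by exists b; split => //; rewrite LL'.
Qed.

Lemma interior_facets_cancel n m (l : ('I_n -> nat) -> nat) (k j : nat) :
  0 < j <= k -> k < n ->
  \big[addb/false]_(s : kuhn_simplex n m | kuhn_face k.+1 s)
    facet_labels k.+1 j (fun b => l (kuhn_vertex s b)) = false.
Proof.
move=> /andP[j0 jk] kn.
have jn : j < n by exact: leq_ltn_trans kn.
have jn' : j.-1 < n by lia.
pose a := Ordinal jn'; pose b := Ordinal jn.
have ba : b = a.+1 :> nat by rewrite /= prednK.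
have ab : a != b by apply/eqP => /(congr1 val) /=; lia.
(* The swap exchanges the simplices satisfying Q with the other ones. *)
pose Q (s : kuhn_simplex n m) := (s.2^-1)%g a < (s.2^-1)%g b.
rewrite (bigID Q) /= [X in _ (+) X](reindex_inj (@kuhn_swap_inj n m a b)) /=.
rewrite [X in X (+) _ = _](eq_bigl (fun s =>
    kuhn_face k.+1 (kuhn_swap a b s) && ~~ Q (kuhn_swap a b s))); last first.
  move=> s; congr (_ && _).
    apply/idP/idP => fs; last rewrite -(kuhn_swapK a b s).
      by apply: kuhn_swap_face => //=; lia.
    by apply: kuhn_swap_face => //=; lia.
  rewrite /Q /kuhn_swap /= invMg !permM tpermV tpermL tpermR -leqNgt.
  rewrite [in RHS]leq_eqVlt; case: eqP => // /val_inj /perm_inj e.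
  by rewrite e eqxx in ab.
rewrite [X in _ (+) X](eq_bigr (fun s =>
    facet_labels k.+1 j (fun b0 => l (kuhn_vertex s b0)))) ?addbb //.
move=> s _; apply: facet_labels_eq => c cj.
by rewrite kuhn_swap_vertex.
Qed.

(** The cyclic shift of [0, ..., k], which lowers every positive element by
    one and sends [0] to [k]. *)
Definition rot_down (n k : nat) (i : 'I_n) : 'I_n :=
  insubd i (if i == 0 :> nat then k else if i <= k then i.-1 else i).

Lemma rot_downE n k (i : 'I_n) : k < n -> rot_down k i =
  (if i == 0 :> nat then k else if i <= k then i.-1 else i) :> nat.
Proof.
move=> kn; rewrite /rot_down val_insubd.
have := ltn_ord i; case: eqP => [_|i0] i_n; first by rewrite kn.
by case: (leqP i k) => ik; rewrite ?i_n ?(leq_ltn_trans (leq_pred i) i_n).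
Qed.

Lemma rot_down_inj n k : k < n -> injective (@rot_down n k).
Proof.
move=> kn x y /(congr1 (@nat_of_ord n)); rewrite !rot_downE // => xy.
apply/ord_inj; move: xy.
by case: eqP => x0; case: eqP => y0; do ?case: ifP => ?; lia.
Qed.

(** The simplex sharing with [s] the facet opposite to the lowest vertex of
    [s]; that facet is opposite to its highest vertex. The first coordinate to
    be increased is incremented cyclically, so that the map is bijective; the
    description above is only valid when that coordinate stays below [m]. *)
Definition kuhn_rot n m k (kn : k < n) (s : kuhn_simplex n m) :
    kuhn_simplex n m :=
  ([ffun i => if s.2 i == 0 :> nat then ordS (s.1 i) else s.1 i],
   (s.2 * perm (rot_down_inj kn))%g).

Lemma ordS_inj m : injective (@ordS m).
Proof. exact: can_inj (@ordSK m). Qed.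

Lemma kuhn_rot_inj n m k (kn : k < n) : injective (@kuhn_rot n m k kn).
Proof.
move=> [v t] [v' t'] [/ffunP vv /mulIg tt]; rewrite -tt in vv *.
congr pair; apply/ffunP => i; have := vv i; rewrite !ffunE /=.
by case: ifP => // _ /ordS_inj.
Qed.

Lemma kuhn_rot_vertex n m k (kn : k < n) (s : kuhn_simplex n m) j :
  j <= k -> (forall i, s.2 i = 0 :> nat -> (s.1 i).+1 < m) ->
  kuhn_vertex (kuhn_rot kn s) j = kuhn_vertex s j.+1.
Proof.
move=> jk sm; apply/funext => i.
rewrite /kuhn_vertex /= ffunE permM permE rot_downE //.
case: eqP => [s0|s0]; rewrite ?s0 /=.
  by rewrite modn_small ?sm // ltnNge jk /= addn0 addn1.
by congr (_ + nat_of_bool _); case: ifP => sk; apply/idP/idP; lia.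
Qed.

Lemma kuhn_rot_face n m k (kn : k < n) (s : kuhn_simplex n m) :
  kuhn_face k.+1 (kuhn_rot kn s) = kuhn_face k.+1 s.
Proof.
have rot_fix (x : 'I_n) : k < x -> rot_down k x = x.
  move=> kx; apply/ord_inj; rewrite rot_downE //.
  by case: eqP; [lia|case: ifP => //; lia].
apply/kuhn_faceP/kuhn_faceP => h i ki; have := h i ki;
  rewrite /= ffunE permM permE.
  case=> vi si; have si' : s.2 i = i.
    by apply: (rot_down_inj kn); rewrite si rot_fix.
  by move: vi; rewrite si'; case: eqP => //; lia.
by case=> vi ->; rewrite rot_fix //; case: eqP => //; lia.
Qed.

(** The labellings of a grid for Sperner's lemma: a label is allowed on the face
    [x i = 0] only if it is at most [i], and the label [i] is not allowed on the
    face [x i = m]. *)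
Section cubical_sperner.
Variables (n m : nat) (l : ('I_n -> nat) -> nat).
Hypothesis l0 : forall x (i : 'I_n),
  (forall i, x i <= m) -> x i = 0 -> l x <= i.
Hypothesis l1 : forall x (i : 'I_n),
  (forall i, x i <= m) -> x i = m -> l x <> i.
Hypothesis ln : forall x, (forall i, x i <= m) -> l x <= n.

Let label (s : kuhn_simplex n m) (b : nat) := l (kuhn_vertex s b).

Let vertex_le (s : kuhn_simplex n m) b i : kuhn_vertex s b i <= m.
Proof.
by rewrite /kuhn_vertex; have := ltn_ord (s.1 i); case: (_ < b) => /=; lia.
Qed.

Let label_le k (s : kuhn_simplex n m) b : k <= n -> kuhn_face k s -> b <= k ->
  label s b <= k.
Proof.
rewrite leq_eqVlt => /orP[/eqP -> _ _|kn fs bk].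
  by apply: ln; exact: vertex_le.
apply: (@l0 _ (Ordinal kn)); first exact: vertex_le.
have [|s1 s2] := kuhn_faceP _ _ fs (Ordinal kn) => //.
by rewrite /kuhn_vertex s1 s2 /= ltnNge bk.
Qed.

(** The facets opposite to the lowest vertices are, by rotation, the facets
    opposite to the highest vertices, except for those of the boundary of the
    face; on the face [x i = m] the label [i] is missing. *)
Lemma first_facets k (kn : k < n) :
  \big[addb/false]_(s : kuhn_simplex n m | kuhn_face k.+1 s)
    facet_labels k.+1 0 (label s) =
  \big[addb/false]_(s : kuhn_simplex n m |
      kuhn_face k.+1 s &&
      [forall i, (s.2 i == k :> nat) ==> (s.1 i != 0 :> nat)])
    facet_labels k.+1 k.+1 (label s).
Proof.
rewrite [RHS](reindex_inj (@kuhn_rot_inj n m k kn)).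
rewrite (bigID (fun s : kuhn_simplex n m =>
  [forall i, (s.2 i == 0 :> nat) ==> ((s.1 i).+1 < m)])) /=.
rewrite [X in _ (+) X]big1 ?addbF; last first.
  move=> s /andP[fs]; rewrite negb_forall => /existsP[i].
  rewrite negb_imply -leqNgt => /andP[/eqP si mi].
  have ik : i < k.+1 by rewrite -(kuhn_face_perm_lt i fs) si.
  apply/negbTE/facet_labelsP => /(_ _ ik)[b [bk b0]].
  apply: l1; first exact: vertex_le.
  have -> : kuhn_vertex s b i = s.1 i + 1.
    by rewrite /kuhn_vertex si; case: b bk b0.
  by have := ltn_ord (s.1 i); lia.
apply: eq_big => [s|s /andP[fs /forallP hs]].
  rewrite kuhn_rot_face; congr (_ && _); apply: eq_forallb => i.
  rewrite /= ffunE permM permE rot_downE //.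
  have := ltn_ord (s.1 i); case: eqP => s0 /= si.
    rewrite eqxx /=; have [sm|sm] := ltnP (s.1 i).+1 m.
      by rewrite modn_small.
    have -> : (s.1 i).+1 = m by lia.
    by rewrite modnn.
  by case: ifP => sk //=; [case: eqP => //; lia|case: eqP => //; lia].
have sm i : s.2 i = 0 :> nat -> (s.1 i).+1 < m.
  by move=> si; have := hs i; rewrite si eqxx.
apply/facet_labelsP/facet_labelsP => h a /h[b [bk b0 lb]].
  exists b.-1; split; [lia|lia|].
  rewrite -lb /label kuhn_rot_vertex //; [by rewrite prednK //; lia|lia].
exists b.+1; split; [lia|lia|].
by rewrite -lb /label kuhn_rot_vertex //; lia.
Qed.

(** On a face [x i = 0] all labels are at most [i]: among the boundary facets
    opposite to highest vertices, only those of the face [x k = 0] can carry all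
    the labels [0, ..., k], and these facets are the [k]-simplices. *)
Lemma last_facets k (kn : k < n) :
  \big[addb/false]_(s : kuhn_simplex n m |
      kuhn_face k.+1 s &&
      ~~ [forall i, (s.2 i == k :> nat) ==> (s.1 i != 0 :> nat)])
    facet_labels k.+1 k.+1 (label s) =
  \big[addb/false]_(s : kuhn_simplex n m | kuhn_face k s)
    full_labels k (label s).
Proof.
rewrite (bigID (@kuhn_face n m k)) /= [X in _ (+) X]big1 ?addbF; last first.
  move=> s /andP[/andP[fs]]; rewrite negb_forall => /existsP[i].
  rewrite negb_imply negbK => /andP[/eqP si /eqP vi] nfs.
  apply/negbTE/facet_labelsP => /(_ k (leqnn _))[b [bk bk1 lb]].
  have : l (kuhn_vertex s b) <= i.
    by apply: l0; [exact: vertex_le|rewrite /kuhn_vertex si vi; lia].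
  rewrite -/(label s b) lb => ki.
  have ik : i < k.+1 by rewrite -(kuhn_face_perm_lt i fs) si.
  have {ki ik} ik : i = k :> nat by lia.
  case/negP: nfs; apply/kuhn_faceP => i'.
  rewrite leq_eqVlt => /orP[/eqP ki'|ki'].
    have -> : i' = i by apply/ord_inj; lia.
    by split; [exact: vi|apply/ord_inj; rewrite si ik].
  exact: (kuhn_faceP _ _ fs).
apply: eq_big => s; last by rewrite facet_labels_last.
apply/andP/idP => [[]//|fs]; split => //; apply/andP; split.
  by apply/kuhn_faceP => i ki; apply: (kuhn_faceP _ _ fs); lia.
rewrite negb_forall; apply/existsP; exists (Ordinal kn).
have [|s1 s2] := kuhn_faceP _ _ fs (Ordinal kn) => //.
by rewrite s1 s2 /= eqxx.
Qed.

Lemma full_labels_odd (k : nat) : 0 < m -> k <= n ->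
  \big[addb/false]_(s : kuhn_simplex n m | kuhn_face k s)
    full_labels k (label s) = true.
Proof.
move=> m0; elim: k => [_|k IH kn].
  rewrite (big_pred1 ([ffun=> Ordinal m0], 1%g)); last first.
    move=> s; apply/kuhn_faceP/eqP => [fs|-> i _]; last by rewrite ffunE perm1.
    case: s fs => v t fs; congr pair.
      by apply/ffunP => i; apply/ord_inj; rewrite ffunE; have [] := fs i isT.
    by apply/permP => i; rewrite perm1; have [] := fs i isT.
  apply/full_labelsP => a; rewrite leqn0 => /eqP ->; exists 0 => //.
  apply/eqP; rewrite -leqn0; apply: label_le => //.
  by apply/kuhn_faceP => i _; rewrite ffunE perm1.
transitivity (\big[addb/false]_(s : kuhn_simplex n m | kuhn_face k.+1 s)
    \big[addb/false]_(j < k.+2) facet_labels k.+1 j (label s)).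
  apply: eq_bigr => s fs; rewrite facet_labels_parity // => b bk.
  exact: label_le.
rewrite exchange_big /= big_ord_recl big_ord_recr /=.
rewrite [X in _ (+) (X (+) _)]big1; last first.
  move=> j _; rewrite /bump /= add1n; apply: interior_facets_cancel => //.
  exact: ltn_ord.
rewrite (first_facets kn) addFb.
rewrite [X in _ (+) X](bigID (fun s : kuhn_simplex n m =>
  [forall i, (s.2 i == k :> nat) ==> (s.1 i != 0 :> nat)])) /=.
rewrite addbA addbb addFb (last_facets kn); exact: IH (ltnW kn).
Qed.

(** Some cube of the grid has all the labels [0, ..., n] among its vertices. *)
Theorem cubical_sperner : 0 < m ->
  exists v : 'I_n -> nat, (forall i, v i < m) /\
    forall a, a <= n -> exists x : 'I_n -> nat,
      l x = a /\ forall i, v i <= x i <= (v i).+1.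
Proof.
move=> m0.
have [s fs] : exists s : kuhn_simplex n m, full_labels n (label s).
  apply: contrapT => ns; have := full_labels_odd m0 (leqnn n).
  by rewrite big1 // => s _; apply/negbTE/negP => fs; apply: ns; exists s.
exists (fun i => nat_of_ord (s.1 i)); split => [i|a an]; first exact: ltn_ord.
have [b _ lb] := full_labelsP _ _ fs a an.
exists (kuhn_vertex s b); split => // i; rewrite /kuhn_vertex.
by case: (_ < b); lia.
Qed.

End cubical_sperner.

End combinatorics.

(** * Subspaces and finite covers *)

Section Subspaces.
Context {T : topologicalType} (A : set T).

Lemma open_set_typeP (U : set A) :
  open U <-> exists2 V : set T, open V & U = set_val @^-1` V.
Proof.
split; last by case=> V oV ->; exists V.
by case=> V oV <-; exists V.
Qed.

Lemma set_val_continuous : continuous (set_val : A -> T).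
Proof. exact: initial_continuous. Qed.

Lemma hausdorff_set_type : hausdorff_space T -> hausdorff_space A.
Proof.
move=> hT x y xy; apply/val_inj/hT => U V Ux Vy.
have [z [Uz Vz]] := xy _ _ (set_val_continuous Ux) (set_val_continuous Vy).
by exists (set_val z).
Qed.

Lemma compact_set_type : compact A -> compact [set: A].
Proof.
move=> cA F FF _; have FvA : (set_val @ F) A.
  by apply: (@filterS _ F _ setT); [move=> x _; exact: set_valP|exact: filterT].
have [p [Ap clp]] := cA _ _ FvA.
exists (SigSub (mem_set Ap)); split=> // U V FU [_ [[W oW <-] /= Wp WV]].
have [_ [[x Ux <-] Wx]] : (set_val @` U) `&` W !=set0.
  apply: clp; last by apply: open_nbhs_nbhs; split.
  by apply: (@filterS _ F _ U) => // x Ux; exists x.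
by exists x; split => //; exact: WV.
Qed.

End Subspaces.

Lemma large_ind_small_ind (n : nat) (Y : topologicalType) :
  hausdorff_space Y -> large_ind_lt n Y -> small_ind_lt n Y.
Proof.
elim: n Y => [//|n IH] Y hY LY x B cB nBx.
have [|||L [cL pL] dL] := LY [set x] B => //.
- by apply: accessible_closed_set1; exact: hausdorff_accessible.
- by rewrite -subset0 => _ [->].
by exists L => //; apply: IH => //; exact: hausdorff_set_type.
Qed.

(** The covering dimension in terms of indexed covers: every open cover
    indexed by a finite type shrinks, index by index, to an open cover such
    that no point lies in more than [n] members. *)
Definition shrinkable (n : nat) (Y : topologicalType) : Prop :=
  forall (I : finType) (U : I -> set Y), (forall i, open (U i)) ->
    \bigcup_i U i = [set: Y] ->
    exists W : I -> set Y, [/\ forall i, open (W i), forall i, W i `<=` U i,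
      \bigcup_i W i = [set: Y] & forall y, (#|[pred i | `[< W i y >]]| <= n)%N].

Lemma card_finpred (I : finType) (P : pred I) : ([set` P] #= `I_#|P|)%card.
Proof.
apply/card_set_bijP; exists (fun x => index x (enum P)); split.
- by move=> x /= Px; rewrite cardE index_mem mem_enum.
- move=> x y; rewrite !inE /= => Px Py exy.
  by rewrite -(nth_index x (_ : x \in enum P)) ?mem_enum // exy
    nth_index ?mem_enum.
- move=> k /= kP; rewrite cardE in kP.
  have [x0 _] : exists x0 : I, True by case: (enum P) kP => // x0; exists x0.
  exists (nth x0 (enum P) k); last by rewrite index_uniq // enum_uniq.
  by have := mem_nth x0 kP; rewrite mem_enum.
Qed.

Lemma card_le_finpred (I : finType) (P : pred I) n :
  ([set` P] #<= `I_n)%card = (#|P| <= n)%N.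
Proof. by rewrite (card_le_eql (card_finpred P)) card_le_II. Qed.

Lemma covering_dim_shrinkable (n : nat) (Y : topologicalType) :
  covering_dim_lt n Y -> shrinkable n Y.
Proof.
move=> dY I U oU cU.
have [|D [[finD oD cD] DU ordD]] := dY (range U).
  split; first exact/finite_image/finite_finset.
    by move=> _ [i _ <-].
  by rewrite -cU; apply/seteqP; split=> y [];
    [move=> _ [i _ <-] ?; exists i|move=> i _ ?; exists (U i) => //; exists i].
have [[i0 _]|nI] := pselect (exists i : I, True); last first.
  have nY (y : Y) : False.
    have : [set: Y] y by []. by rewrite -cU => -[i _ _]; apply: nI; exists i.
  by exists U; split => [i|i||y] //; case: (nY y).
have /choice[idx idxP] V : exists i, D V -> V `<=` U i.
  have [DV|nDV] := pselect (D V); last by exists i0 => /nDV.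
  by have [_ [i _ <-] VU] := DU _ DV; exists i.
exists (fun i => \bigcup_(V in [set V | D V /\ idx V = i]) V); split.
- by move=> i; apply: bigcup_open => V [/oD].
- by move=> i y [V [DV <-]]; exact: idxP.
- apply/seteqP; split => // y _; have : [set: Y] y by [].
  by rewrite -cD => -[V DV Vy]; exists (idx V) => //; exists V.
move=> y; rewrite -card_le_finpred; apply: card_le_trans (ordD y).
apply: (card_le_trans _ (card_image_le idx _)); apply: subset_card_le.
move=> i /= /asboolP[V [DV <-] Vy].
by exists V.
Qed.

Lemma shrinkable_covering_dim (n : nat) (Y : topologicalType) :
  shrinkable n Y -> covering_dim_lt n Y.
Proof.
move=> sY C [/finite_seqP[s Cs] oC cC].
pose U (i : 'I_(size s)) := nth set0 s i.
have CU i : C (U i) by rewrite Cs /=; apply: mem_nth.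
have [||W [oW WU cW ordW]] := sY _ U.
- by move=> i; exact: oC.
- rewrite -cC; apply/seteqP; split=> y [].
    by move=> i _ Uy; exists (U i).
  rewrite Cs => V /= /(nthP set0)[k ks <-] Vy.
  by exists (Ordinal ks).
exists (range W); split.
- split; first exact/finite_image/finite_finset.
    by move=> _ [i _ <-].
  rewrite -cW; apply/seteqP; split=> y [].
    by move=> _ [i _ <-] ?; exists i.
  by move=> i _ ?; exists (W i) => //; exists i.
- by move=> _ [i _ <-]; exists (U i); last exact: WU.
move=> y; apply: (@card_le_trans _ _ _ [set` [pred i | `[< W i y >]]]).
  apply: (card_le_trans _ (card_image_le W _)); apply: subset_card_le.
  by move=> _ [[i _ <-] Wiy]; exists i => //; apply/asboolP.
rewrite card_le_finpred; exact: ordW.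
Qed.

Lemma leq_card_asbool (I : finType) (P Q : I -> Prop) :
  (forall i, P i -> Q i) ->
  (#|[pred i | `[< P i >]]| <= #|[pred i | `[< Q i >]]|)%N.
Proof.
move=> PQ; apply/subset_leq_card/fintype.subsetP => i /asboolP Pi.
exact/asboolP/PQ.
Qed.

(** A compact set is covered by finitely many of given neighbourhoods of its
    points. The proof uses the filter generated by the sets of all finite
    sequences that contain a given one. *)
Lemma compact_finite_subcover (Y : topologicalType) (K : set Y)
    (V : Y -> set Y) : compact K -> (forall y, K y -> nbhs y (V y)) ->
  exists s : seq Y, (forall y, y \in s -> K y) /\
    forall x, K x -> exists2 y, y \in s & V y x.
Proof.
move=> /compact_near_coveringP cK nV.
pose F := filter_from setT
  (fun s0 : seq Y => [set s : seq Y | {subset s0 <= s}]).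
have FF : Filter F.
  apply: filter_from_filter; first by exists [::].
  move=> s t _ _; exists (s ++ t) => // u su.
  by split=> y ys; apply: su; rewrite mem_cat ys ?orbT.
have [x Kx|s0 _ /(_ s0) s0P] := cK _ F
    (fun (s : seq Y) (x : Y) => exists2 y : Y, (y \in s) && `[< K y >] & V y x)
    FF.
  exists (V x, [set s : seq Y | {subset [:: x] <= s}]) => /=.
    by split; [exact: nV|exists [:: x]].
  move=> [x' s] /= [Vx' xs]; exists x => //; apply/andP; split.
    by apply: xs; rewrite inE.
  exact/asboolP.
exists [seq y <- s0 | `[< K y >]]; split.
  by move=> y; rewrite mem_filter => /andP[/asboolP].
move=> x Kx; have [//|y /andP[ys Ky] Vy] := s0P _ x Kx.
by exists y => //; rewrite mem_filter ys Ky.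
Qed.

(** * The covering dimension is at most the small inductive dimension *)

(** Every finite open cover of a normal space has an open shrinking whose
    closures still lie in the members of the cover. *)
Lemma closure_shrinking (R : realType) (Y : topologicalType) (I : finType)
    (W : I -> set Y) : normal_space Y -> (forall i, open (W i)) ->
  \bigcup_i W i = [set: Y] ->
  exists G : I -> set Y, [/\ forall i, open (G i),
    forall i, closure (G i) `<=` W i & \bigcup_i G i = [set: Y]].
Proof.
move=> nY oW cW.
suff [G [oG GW sG cG]] : exists G : I -> set Y, [/\ forall i, open (G i),
    forall i, G i `<=` W i, forall i, i \in enum I -> closure (G i) `<=` W i &
    \bigcup_i G i = [set: Y]].
  by exists G; split => // i; apply: sG; rewrite mem_enum.
(* The members are shrunk one at a time. *)
elim: (enum I) => [|i s [G [oG GW sG cG]]].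
  by exists W; split => // i; exact: subset_refl.
pose A := ~` \bigcup_(j in [set j | j != i]) G j.
have cA : closed A by apply/open_closedC/bigcup_open => j _; exact: oG.
have AG : A `<=` G i.
  move=> y nAy; have : [set: Y] y by []. rewrite -cG => -[j _ Gjy].
  by have [<-//|ji] := eqVneq j i; exfalso; apply: nAy; exists j.
have AG0 : A `&` ~` G i = set0 by rewrite -subset0 => y [/AG].
have [U [V [oU oV AU GV UV]]] := (@normal_openP R Y).1 nY A (~` G i) cA
  (open_closedC (oG i)) AG0.
have cVG : closure U `<=` G i.
  have : closure U `<=` ~` V.
    rewrite [X in _ `<=` X](_ : _ = closure (~` V)); last first.
      by apply/closure_id/open_closedC.
    apply: closureS => y Uy Vy; have : (U `&` V) y by [].
    by rewrite UV.
  by move/subset_trans; apply => y nVy; apply: contrapT => /GV.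
exists (fun j => if j == i then U else G j); split.
- by move=> j; case: ifP.
- move=> j; case: eqP => [->|_]; last exact: GW.
  apply: subset_trans (GW i); apply: subset_trans cVG; exact: subset_closure.
- move=> j; rewrite inE; case: eqP => [-> _|_ /=]; last exact: sG.
  by apply: subset_trans (GW i).
- apply/seteqP; split => // y _.
  have [[j /= ji Gjy]|nAy] := pselect ((\bigcup_(j in [set j | j != i]) G j) y).
    by exists j; rewrite // (negbTE ji).
  by exists i; rewrite // eqxx; exact: AU.
Qed.

(** A shrinking of the trace of a cover on a closed subspace extends to the
    whole space, since nothing is required outside of the subspace. *)
Lemma shrinkable_closed_subspace n (Y : topologicalType) (L : set Y)
    (I : finType) (U : I -> set Y) :
  closed L -> shrinkable n L -> (forall i, open (U i)) ->
  \bigcup_i U i = [set: Y] ->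
  exists W : I -> set Y, [/\ forall i, open (W i), forall i, W i `<=` U i,
    \bigcup_i W i = [set: Y] &
    forall y, L y -> (#|[pred i | `[< W i y >]]| <= n)%N].
Proof.
move=> cL sL oU cU.
have [||V [oV VU cV ordV]] := sL I (fun i => set_val @^-1` U i).
- by move=> i; apply/open_set_typeP; exists (U i).
- apply/seteqP; split => // y _; have : [set: Y] (set_val y) by [].
  by rewrite -cU => -[i _ Uiy]; exists i.
have /choice[N NP] i : exists N, open N /\ V i = set_val @^-1` N.
  by have /open_set_typeP[N oN ->] := oV i; exists N.
exists (fun i => U i `&` (N i `|` ~` L)); split.
- move=> i; apply: openI => //; apply: openU; first by have [] := NP i.
  exact: closed_openC.
- by move=> i y [].
- apply/seteqP; split => // y _.
  have [Ly|nLy] := pselect (L y).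
    have : [set: L] (SigSub (mem_set Ly)) by []. rewrite -cV => -[i _ Viy].
    exists i => //; split; first exact: (VU _ _ Viy).
    by left; move: Viy; rewrite (NP i).2.
  have : [set: Y] y by []. rewrite -cU => -[i _ Uiy].
  by exists i => //; split => //; right.
move=> y Ly; apply: leq_trans (ordV (SigSub (mem_set Ly))).
apply: leq_card_asbool => i [_ []// Ny]; by rewrite (NP i).2; exact: Ny.
Qed.

(** The finite closed sum theorem, in the form: a cover can be shrunk so as to
    have order at most [n] on each of finitely many closed subspaces. *)
Lemma shrinkable_closed_sum n (Y : topologicalType) (Ls : seq (set Y))
    (I : finType) (U : I -> set Y) :
  (forall L : set Y, L \in Ls -> closed L /\ shrinkable n L) ->
  (forall i, open (U i)) ->
  \bigcup_i U i = [set: Y] ->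
  exists W : I -> set Y, [/\ forall i, open (W i), forall i, W i `<=` U i,
    \bigcup_i W i = [set: Y] &
    forall (L : set Y) y, L \in Ls -> L y ->
      (#|[pred i | `[< W i y >]]| <= n)%N].
Proof.
elim: Ls => [|L Ls IH] hL oU cU.
  by exists U; split => // i; exact: subset_refl.
have [|V [oV VU cV ordV]] := IH _ oU cU.
  by move=> L' L's; apply: hL; rewrite inE L's orbT.
have [|cL sL] := hL L; first by rewrite inE eqxx.
have [W [oW WV cW ordW]] := shrinkable_closed_subspace cL sL oV cV.
exists W; split => //; first by move=> i; exact: subset_trans (VU i).
move=> L' y; rewrite inE => /orP[/eqP ->|L's]; first exact: ordW.
move=> L'y; apply: leq_trans (ordV _ _ L's L'y).
by apply: leq_card_asbool => i; exact: WV.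
Qed.

(** Finitely many open sets [V] with boundaries in sets satisfying [P], made
    disjoint: the later sets are cut along the boundaries of the earlier ones,
    and the resulting family covers everything but these boundaries. The set
    [V'] plays the role of the exterior of [V], and [L] that of its boundary. *)
Lemma disjoint_open_refinement (Y : topologicalType) (I : finType)
    (P : set Y -> Prop) (U : I -> set Y) (s : seq (set Y)) :
  (forall V : set Y, V \in s -> open V /\
    exists i (V' L : set Y), [/\ open V', V `&` V' = set0,
      ~` L = V `|` V', V `<=` U i & P L]) ->
  exists (Z : I -> set Y) (Ls : seq (set Y)), [/\ forall i, open (Z i),
    forall i, Z i `<=` U i, forall i j y, Z i y -> Z j y -> i = j,
    forall L : set Y, L \in Ls -> P L &
    forall (V : set Y) y, V \in s -> V y ->
      (exists i, Z i y) \/ (exists2 L : set Y, L \in Ls & L y)].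
Proof.
elim: s => [|V s IH] hs.
  by exists (fun=> set0), [::]; split => [i|i y|i j y|L|V y] //; exact: open0.
have [|Z [Ls [oZ ZU dZ PLs cs]]] := IH.
  by move=> V' V's; apply: hs; rewrite inE V's orbT.
have [|oV [i [V' [L [oV' VV' LV VU PL]]]]] := hs V; first by rewrite inE eqxx.
exists (fun j => (if j == i then V else set0) `|` (Z j `&` V')), (L :: Ls).
have dV y : V y -> V' y -> False.
  by move=> Vy V'y; have : (V `&` V') y by []; rewrite VV'.
split.
- by move=> j; apply: openU; [case: eqP => // _; exact: open0|exact: openI].
- by move=> j y [|[/ZU//]]; case: eqP => // -> /VU.
- move=> j k y [ej|[Zjy V'y]] [ek|[Zky V'y']].
  + by move: ej ek; case: eqP => // ->; case: eqP.
  + by move: ej; case: eqP => // _ /dV /(_ V'y').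
  + by move: ek; case: eqP => // _ /dV /(_ V'y).
  + exact: dZ Zjy Zky.
- by move=> L'; rewrite inE => /orP[/eqP ->//|/PLs].
move=> V0 y; rewrite inE => /orP[/eqP -> Vy|V0s V0y].
  by left; exists i; rewrite eqxx; left.
have [Ly|nLy] := pselect (L y); first by right; exists L; rewrite // inE eqxx.
have : (~` L) y by []. rewrite LV => -[Vy|V'y].
  by left; exists i; rewrite eqxx; left.
have [[j Zjy]|[L' L's L'y]] := cs _ _ V0s V0y; first by left; exists j; right.
by right; exists L' => //; rewrite inE L's orbT.
Qed.

(** On a compact Hausdorff space, dim <= ind. *)
Theorem small_ind_shrinkable (R : realType) (n : nat) (Y : topologicalType) :
  hausdorff_space Y -> compact [set: Y] -> small_ind_lt n Y -> shrinkable n Y.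
Proof.
elim: n Y => [|n IH] Y hY cY /= indY I U oU cU.
  have nY (y : Y) : False.
    by have : [set: Y] y by []; rewrite indY.
  exists (fun=> set0); split => [i|i y||y]; last by case: (nY y).
  - exact: open0.
  - by [].
  - by apply/seteqP; split => // y; case: (nY y).
have nY : normal_space Y by exact: compact_normal.
pose P (L : set Y) := closed L /\ small_ind_lt n L.
have /choice[V VP] (y : Y) : exists V : set Y, [/\ open V, V y &
    exists i (V' L : set Y), [/\ open V', V `&` V' = set0, ~` L = V `|` V',
      V `<=` U i & P L]].
  have : [set: Y] y by []. rewrite -cU => -[i _ Uiy].
  have [|//|L [cL [V [V' [[oV oV'] yV UV' VV' LV]]]] dL] :=
    indY y (~` U i); first exact: open_closedC.
  exists V; split => //; first exact: yV.
  exists i, V', L; split => // z Vz; apply: contrapT => /UV' V'z.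
  by have : (V `&` V') z by []; rewrite VV'.
have [|D [_ cD]] := @compact_finite_subcover Y setT V cY.
  by move=> y _; have [oV yV _] := VP y; exact: open_nbhs_nbhs.
have [|Z [Ls [oZ ZU dZ PLs cZ]]] :=
    @disjoint_open_refinement Y I P U [seq V y | y <- D].
  by move=> _ /mapP[y _ ->]; have [] := VP y.
have [|W [oW WU cW ordW]] := @shrinkable_closed_sum n Y Ls I U _ oU cU.
  move=> L /PLs[cL indL]; split => //; apply: IH => //.
    exact: hausdorff_set_type.
  by apply: compact_set_type; exact: (subclosed_compact cL cY).
have [G [oG GW cG]] := closure_shrinking R nY oW cW.
(* E is the set of points in more than n of the sets closure (G i); it is closed
   and does not meet the boundaries in Ls. The final cover consists of the sets
   G i outside of E, of order at most n, and of the disjoint sets Z i. *)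
pose E := \bigcup_(J in [set J : {ffun I -> bool} | (n < #|[pred i | J i]|)%N])
  \bigcap_(i in [set i | J i]) closure (G i).
have EP y : ~ E y <-> (#|[pred i | `[< closure (G i) y >]]| <= n)%N.
  split=> [nEy|lecard [J /= nJ Jy]].
    rewrite leqNgt; apply/negP => nc; apply: nEy.
    exists [ffun i => `[< closure (G i) y >]].
      apply: leq_trans nc _; apply/subset_leq_card/fintype.subsetP => i.
      by rewrite /in_mem /= ffunE.
    by move=> i /=; rewrite ffunE => /asboolP.
  have leJ : (#|[pred i | J i]| <= #|[pred i | `[< closure (G i) y >]]|)%N.
    by apply/subset_leq_card/fintype.subsetP => i Ji; apply/asboolP/Jy.
  by have := leq_trans nJ (leq_trans leJ lecard); rewrite ltnn.
have cE : closed E.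
  apply: closed_bigcup; first exact: finite_finset.
  by move=> J _; apply: closed_bigI => i _; exact: closed_closure.
exists (fun i => (G i `\` E) `|` Z i); split.
- move=> i; apply: openU => //; apply: openI => //; exact: closed_openC.
- move=> i y [[Giy _]|/ZU//]; apply/WU/GW; exact: subset_closure.
- apply/seteqP; split => // y _; have : [set: Y] y by [].
  move=> /cD[x xD Vxy].
  have [|[i Ziy]|[L Ls_L Ly]] := cZ (V x) y _ Vxy; first exact: map_f.
    by exists i => //; right.
  have : [set: Y] y by []. rewrite -cG => -[i _ Giy].
  exists i => //; left; split => //; apply/EP.
  apply: leq_trans (ordW L y Ls_L Ly).
  by apply: leq_card_asbool => j; exact: GW.
move=> y.
have [[i0 Ziy]|nZ] := pselect (exists i, Z i y).
  have [Ey|/EP nEy] := pselect (E y).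
    apply: (@leq_trans 1) => //; rewrite -(card1 i0).
    apply/subset_leq_card/fintype.subsetP => i /asboolP[[]//|Zi].
    by apply/eqP; exact: dZ Zi Ziy.
  apply: (@leq_trans #|[predU1 i0 & [pred i | `[< closure (G i) y >]]]|).
    apply/subset_leq_card/fintype.subsetP => i /asboolP[[Gi _]|Zi].
      by apply/orP; right; apply/asboolP; exact: subset_closure.
    by apply/orP; left; apply/eqP; exact: dZ Zi Ziy.
  rewrite cardU1 -add1n; apply: leq_add => //; exact: leq_b1.
have [Ey|/EP nEy] := pselect (E y).
  rewrite eq_card0 // => i; apply/asboolP => -[[]//|Zi].
  by apply: nZ; exists i.
apply: leq_trans (leqW nEy); apply: leq_card_asbool => i [[Gi _]|Zi].
  exact: subset_closure.
by case: nZ; exists i.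
Qed.

(** * Partitions of a cube along grids *)

(** Disjoint compact sets separated by finitely many continuous functions are
    uniformly separated by them. *)
Lemma coordinates_separation (R : realType) (Y : topologicalType) (N : nat)
    (f : 'I_N -> Y -> R) (A B : set Y) :
  compact A -> compact B -> (forall i, continuous (f i)) ->
  (forall a b, A a -> B b -> exists i, f i a <> f i b) ->
  exists2 e : R, 0 < e &
    forall a b, A a -> B b -> exists i, e <= `|f i a - f i b|.
Proof.
move=> cA cB cf sep.
have cAB : compact (A `*` B) by exact: compact_setX.
have H : \forall e \near (0 : R)^'+,
    A `*` B `<=` (fun ab => exists i, e <= `|f i ab.1 - f i ab.2|).
  move/compact_near_coveringP : cAB => /(_ R (0^'+)
    (fun e ab => exists i, e <= `|f i ab.1 - f i ab.2|)); apply.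
  move=> [a b] [/= Aa Bb]; have [i fi] := sep _ _ Aa Bb.
  pose r : R := `|f i a - f i b| / 4.
  have r0 : 0 < r by rewrite divr_gt0 // normr_gt0 subr_eq0; apply/eqP.
  have na : \forall a' \near a, `|f i a - f i a'| < r.
    exact: cvgr_dist_lt (cf i a) r r0.
  have nb : \forall b' \near b, `|f i b - f i b'| < r.
    exact: cvgr_dist_lt (cf i b) r r0.
  exists ([set ab | `|f i a - f i ab.1| < r /\ `|f i b - f i ab.2| < r],
    [set e | e < r]) => /=.
    split; last exact: nbhs_right_lt.
    by exists ([set a' | `|f i a - f i a'| < r],
      [set b' | `|f i b - f i b'| < r]).
  move=> [[a' b'] e] /= [[ha hb] er]; exists i.
  have := ler_distD (f i a') (f i a) (f i b).
  have := ler_distD (f i b') (f i a') (f i b).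
  rewrite (distrC (f i b') (f i b)).
  have -> : `|f i a - f i b| = 4 * r by rewrite /r mulrC divfK.
  lra.
have [e [e0 he]] := filter_ex (filterI (nbhs_right_gt 0) H).
by exists e => // a b Aa Bb; apply: (he (a, b)).
Qed.

Lemma avoid_seq (R : realType) (s : seq R) (a b : R) : a < b ->
  exists x, [/\ a < x, x < b & x \notin s].
Proof.
elim: s a b => [|t s IH] a b ab; first by exists ((a + b) / 2); split=> //; lra.
have [tm|mt] := leP t ((a + b) / 2).
  have [|x [ax xb xs]] := IH ((a + b) / 2) b; first by lra.
  exists x; split => //; first by lra.
  by rewrite inE negb_or xs andbT gt_eqF //; lra.
have [|x [ax xb xs]] := IH a ((a + b) / 2); first by lra.
exists x; split => //; first by lra.
by rewrite inE negb_or xs andbT lt_eqF //; lra.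
Qed.

(** The closed cells of a grid: the coordinate [f i] of a point of the cell [c]
    lies in the closed interval of length [de] starting at [t0 + c i * de]. *)
Definition grid_cell (R : realType) (Y : Type) (N m : nat)
    (f : 'I_N -> Y -> R) (t0 de : R) (c : {ffun 'I_N -> 'I_m}) : set Y :=
  [set y | forall i, t0 + (c i)%:R * de <= f i y <= t0 + (c i).+1%:R * de].

Lemma closed_grid_cell (R : realType) (Y : topologicalType) (N m : nat)
    (f : 'I_N -> Y -> R) (t0 de : R) (c : {ffun 'I_N -> 'I_m}) :
  (forall i, continuous (f i)) -> closed (grid_cell f t0 de c).
Proof.
move=> cf.
rewrite (_ : grid_cell _ _ _ _ = \bigcap_i
  (f i @^-1` `[t0 + (c i)%:R * de, t0 + (c i).+1%:R * de]%classic)).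
  apply: closed_bigI => i _; apply: preimage_closed.
    by move=> y _; exact: cf.
  exact: itv_closed.
apply/seteqP; split => y.
  by move=> cy i _ /=; rewrite in_itv; exact: cy.
by move=> cy i; have := cy i I; rewrite /= in_itv.
Qed.

Lemma grid_cell_cover (R : realType) (Y : Type) (N m : nat)
    (f : 'I_N -> Y -> R) (t0 de : R) (y : Y) : 0 < de ->
  (forall i, t0 <= f i y < t0 + m%:R * de) ->
  exists c : {ffun 'I_N -> 'I_m}, grid_cell f t0 de c y.
Proof.
move=> de0 fy.
have /choice[c cP] i : exists k : 'I_m,
    t0 + k%:R * de <= f i y <= t0 + k.+1%:R * de.
  have /andP[f0 fm] := fy i.
  have g0 : 0 <= (f i y - t0) / de by rewrite divr_ge0 ?subr_ge0 // ltW.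
  have := truncn_itv g0; set k := Num.truncn _ => /andP[kl ku].
  have km : (k < m)%N.
    rewrite -(ltr_nat R); apply: le_lt_trans kl _.
    by rewrite ltr_pdivrMr // ltrBlDl.
  exists (Ordinal km) => /=; move: kl ku.
  by rewrite ler_pdivlMr // ltr_pdivrMr // => *; apply/andP; split; lra.
by exists [ffun i => c i] => i; rewrite ffunE.
Qed.

(** A compact space embedded in the unit cube of dimension [N], all of whose
    points have more than [N - k] coordinates in a fixed finite set [T], has
    large inductive dimension less than [k]. Disjoint closed sets [A] and [B]
    are separated by the intersection of the union of the cells that meet [A],
    for a fine enough grid, with the union of the other cells; at its points one
    more coordinate is on a wall of the grid, and the walls avoid [T]. *)
Theorem large_ind_lt_grid (R : realType) (k N : nat) (Y : topologicalType)
    (f : 'I_N -> Y -> R) (T : seq R) :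
  compact [set: Y] -> (forall i, continuous (f i)) ->
  (forall x y, (forall i, f i x = f i y) -> x = y) ->
  (forall i y, 0 <= f i y <= 1) ->
  (forall y, N < k + #|[pred i | f i y \in T]|)%N ->
  large_ind_lt k Y.
Proof.
elim: k Y f T => [|k IH] Y f T cY cf sep f01 hT /=.
  apply/seteqP; split => // y _; have := hT y.
  by rewrite add0n ltnNge -[X in (_ <= X)%N](card_ord N) max_card.
move=> A B cA cB AB.
have [|||e e0 eAB] := @coordinates_separation R Y N f A B _ _ cf.
- exact: (subclosed_compact cA cY).
- exact: (subclosed_compact cB cY).
- move=> a b Aa Bb; apply: contrapT => nf.
  have ab : a = b.
    by apply: sep => i; apply: contrapT => fi; apply: nf; exists i.
  by suff : (A `&` B) a by [rewrite AB]; split => //; rewrite ab.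
(* Cells of side de < e cannot meet both A and B. With an offset t0 in ]-de, 0[,
   M + 2 cells cover the interval [0, 1], and they have M + 3 walls. *)
pose M := Num.bound (e^-1); pose de : R := (M.+1%:R)^-1.
have de0 : 0 < de by rewrite invr_gt0.
have dee : de < e.
  have eM : e^-1 < M%:R by apply: archi_boundP; rewrite invr_ge0 ltW.
  by rewrite /de invf_plt ?posrE //; apply: lt_trans eM _; rewrite ltr_nat.
have deM : M.+1%:R * de = 1 by rewrite mulfV // pnatr_eq0.
have [|t0 [t0l t0u t0T]] :=
    @avoid_seq R [seq t - j%:R * de | t <- T, j <- iota 0 M.+3] (- de) 0.
  by lra.
pose grid := [seq t0 + j%:R * de | j <- iota 0 M.+3].
have gridT t : t \in grid -> t \notin T.
  move=> /mapP[j jM ->]; apply: contra t0T => tT.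
  apply/allpairsP; exists (t0 + j%:R * de, j); split => //=; lra.
pose cell := @grid_cell R Y N M.+2 f t0 de.
have cover y : exists c, cell c y.
  apply: grid_cell_cover => // i; have /andP[fl fu] := f01 i y.
  have -> : M.+2%:R * de = 1 + de by rewrite -natr1 mulrDl deM mul1r.
  by apply/andP; split; lra.
pose F1 := \bigcup_(c in [set c | cell c `&` A !=set0]) cell c.
pose F2 := \bigcup_(c in [set c | ~ (cell c `&` A !=set0)]) cell c.
have cF P : closed (\bigcup_(c in P) cell c).
  apply: closed_bigcup; first exact: finite_finset.
  by move=> c _; exact: closed_grid_cell.
exists (F1 `&` F2).
  split; first by apply: closedI; exact: cF.
  exists (~` F2), (~` F1); split.
  - by split; apply: closed_openC; exact: cF.
  - by move=> a Aa [c /= nc ca]; apply: nc; exists a.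
  - move=> b Bb [c [a [ca Aa]] cb]; have [i] := eAB _ _ Aa Bb.
    have /andP[] := ca i; have /andP[] := cb i; rewrite -natr1 mulrDl mul1r.
    move=> b1 b2 a1 a2; rewrite leNgt => /negP; apply.
    by rewrite ltr_norml; apply/andP; split; lra.
  - rewrite -subset0 => y [nF2 nF1]; have [c cy] := cover y.
    have [cA'|ncA] := pselect (cell c `&` A !=set0).
      by apply: nF1; exists c.
    by apply: nF2; exists c.
  - by rewrite setCI setUC.
apply: (IH _ (fun i y => f i (set_val y)) (T ++ grid)).
- apply: compact_set_type; apply: (subclosed_compact _ cY) => //.
  by apply: closedI; exact: cF.
- by move=> i y; apply: continuous_comp; [exact: set_val_continuous|exact: cf].
- by move=> x y xy; apply/val_inj/sep => i; exact: xy.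
- by move=> i y; exact: f01.
move=> y; have [[c cA' cy] [c' ncA' c'y]] := set_valP y.
have [i cc'] : exists i, c i != c' i.
  apply: contrapT => nc; apply: ncA'; rewrite (_ : c' = c) //.
  apply/ffunP => i; apply/eqP; apply: contrapT => /negP cc'.
  by apply: nc; exists i; rewrite eq_sym.
(* A coordinate in two distinct cells lies on their common wall. *)
have igrid : f i (set_val y) \in grid.
  have := cy i; have := c'y i.
  wlog lcc : c c' cc' {cA' cy ncA' c'y} / (c i < c' i)%N.
    move=> wl h1 h2; have [l|l|/val_inj e'] := ltngtP (c i) (c' i).
    - exact: (wl c c').
    - by apply: (wl c' c) => //; rewrite eq_sym.
    - by rewrite e' eqxx in cc'.
  move=> /andP[h1 _] /andP[_ h2].
  have : (c i).+1%:R * de <= (c' i)%:R * de by rewrite ler_pM2r // ler_nat.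
  move=> h3; apply/mapP; exists (c' i : nat); last by lra.
  by rewrite mem_iota /= add0n (leq_trans (ltn_ord _)).
apply: leq_trans (hT (set_val y)) _; rewrite addSn -addnS leq_add2l.
have iT : i \notin [pred i | f i (set_val y) \in T] by exact: gridT.
have := cardU1 i [pred i | f i (set_val y) \in T]; rewrite iT add1n => <-.
apply/subset_leq_card/fintype.subsetP => j.
by rewrite !inE mem_cat => /orP[/eqP ->|->//]; rewrite igrid orbT.
Qed.

(** * The dimension of the cube *)

(** The Lebesgue covering theorem: a compact subspace of the [n]-dimensional
    space that contains the unit cube has covering dimension at least [n]. *)
Theorem cube_not_shrinkable (R : realType) (n : nat) (Y : topologicalType)
    (f : 'I_n -> Y -> R) :
  hausdorff_space Y -> compact [set: Y] -> (forall i, continuous (f i)) ->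
  (forall x y, (forall i, f i x = f i y) -> x = y) ->
  (forall q : 'I_n -> R, (forall i, 0 <= q i <= 1) ->
    exists y, forall i, f i y = q i) ->
  ~ shrinkable n Y.
Proof.
move=> hY cY cf sep onto sY.
(* No member of this cover meets two opposite faces of the cube. *)
pose U (c : {ffun 'I_n -> bool}) : set Y := \bigcap_(i in [set: 'I_n])
  (f i @^-1` (if c i then [set r | r < 1] else [set r | 0 < r])).
have [||W [oW WU cW ordW]] := sY _ U.
- move=> c; rewrite -closedC /U setC_bigcap.
  apply: closed_bigcup; first exact: finite_finset.
  move=> i _; apply/open_closedC/open_comp; first by move=> y _; exact: cf.
  by case: ifP => _; [exact: open_lt|exact: open_gt].
- apply/seteqP; split => // y _; exists [ffun i => f i y < 1] => // i _ /=.
  by rewrite ffunE; case: ltP => //= /(lt_le_trans ltr01).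
have [G [oG GW cG]] := closure_shrinking R (compact_normal hY cY) oW cW.
(* A member of the cover W is classified by the first i such that it meets the
   face f i = 0, and by n if it meets none of these faces. *)
pose cls c : nat :=
  find (fun i => `[< exists2 y, W c y & f i y = 0 >]) (enum 'I_n).
have /choice[idx idxP] (y : Y) : exists c, G c y.
  have : [set: Y] y by []. by rewrite -cG => -[c _ Gcy]; exists c.
pose L (a : nat) := \bigcup_(c in [set c | cls c = a]) closure (G c).
have cL a : closed (L a).
  apply: closed_bigcup; first exact: finite_finset.
  by move=> c _; exact: closed_closure.
(* A point in L 0, ..., L n would lie in n + 1 distinct members of W. *)
have LI y : exists2 a, (a <= n)%N & ~ L a y.
  apply: contrapT => nLy.
  have /choice[g gP] (a : 'I_n.+1) : exists c, cls c = a /\ W c y.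
    apply: contrapT => nc; apply: nLy; exists a => [|[c /= ca Gcy]].
      by rewrite -ltnS.
    by apply: nc; exists c; split => //; exact: GW.
  have g_inj : injective g.
    by move=> a b gab; apply/ord_inj; rewrite -(gP a).1 -(gP b).1 gab.
  have := ordW y; rewrite leqNgt => /negP; apply.
  have <- : #|codom g| = n.+1 by rewrite card_codom // card_ord.
  apply/subset_leq_card/fintype.subsetP => _ /codomP[a ->].
  by apply/asboolP; have [] := gP a.
(* By compactness, on a fine enough grid the points of a cube all avoid a common
   L a, in contradiction with the fully labelled cube of Sperner's lemma. *)
have H : \forall m \near \oo, [set: Y] `<=`
    (fun y => exists2 a, (a <= n)%N & forall z,
      (forall i, `|f i z - f i y| <= (m.+1%:R)^-1) -> ~ L a z).
  have /compact_near_coveringP := cY; apply => x _.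
  have [a an nLx] := LI x.
  have [|||e e0 eP] := @coordinates_separation R Y n f [set x] (L a) _ _ cf.
  - exact: compact_set1.
  - exact: (subclosed_compact (cL a) cY).
  - move=> _ b -> Lb; apply: contrapT => nf; apply: nLx.
    suff -> : x = b by [].
    by apply: sep => i; apply: contrapT => fi; apply: nf; exists i.
  have nx : \forall y \near x, forall i, `|f i x - f i y| < e / 2.
    apply: filter_forall => i; apply: cvgr_dist_lt (cf i x) _ _; lra.
  have nm : \forall m \near \oo, (m.+1%:R)^-1 < e / 2 :> R.
    have e20 : 0 < e / 2 by rewrite divr_gt0.
    exact: (near_infty_natSinv_lt (PosNum e20)).
  exists ([set y | forall i, `|f i x - f i y| < e / 2],
     [set m | (m.+1%:R)^-1 < e / 2 :> R]) => //=.
  move=> [y m] /= [fy me]; exists a => // z fz Lz.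
  have [i] := eP x z erefl Lz.
  have := ler_distD (f i y) (f i x) (f i z); have := fy i.
  have := le_lt_trans (fz i) me; rewrite (distrC (f i z)); lra.
have [m mP] := filter_ex H.
have /choice[p pP] (x : 'I_n -> nat) : exists y, (forall i, (x i <= m.+1)%N) ->
    forall i, f i y = (x i)%:R / m.+1%:R.
  have [xm|nxm] := pselect (forall i, (x i <= m.+1)%N).
    have [|y fy] := onto (fun i => (x i)%:R / m.+1%:R); last by exists y.
    move=> i; rewrite divr_ge0 //= ler_pdivrMr // mul1r ler_nat; exact: xm.
  have [|y _] := onto (fun=> 0); first by move=> i; rewrite lexx ler01.
  by exists y.
pose l x := cls (idx (p x)).
have Wp x : W (idx (p x)) (p x) by apply/GW/subset_closure/idxP.
have nth_i (i : 'I_n) : nth i (enum 'I_n) i = i by exact: nth_ord_enum.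
have [|||//|v [vm vP]] := @cubical_sperner n m.+1 l.
- move=> x i xm xi; rewrite leqNgt; apply/negP => /(before_find i).
  rewrite nth_i => /asboolP; apply; exists (p x) => //.
  by rewrite pP // xi mul0r.
- move=> x i xm xi lxi.
  have : has (fun i => `[< exists2 y, W (idx (p x)) y & f i y = 0 >])
      (enum 'I_n).
    by rewrite has_find size_enum_ord -/(cls _) -/(l x) lxi.
  move/(nth_find i); rewrite -/(cls _) -/(l x) lxi nth_i => /asboolP[y Wy fy0].
  have := WU _ _ Wy i I; have := WU _ _ (Wp x) i I.
  rewrite /= pP // xi mulfV ?pnatr_eq0 // fy0.
  by case: ifP => /= _; rewrite ltxx.
- by move=> x xm; rewrite -[X in (_ <= X)%N](size_enum_ord n) find_size.
have vm' i : (v i <= m.+1)%N by exact: ltnW.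
have [a an aP] := mP (p v) I.
have [x [lx xv]] := vP a an.
have xm i : (x i <= m.+1)%N.
  by have /andP[_ h] := xv i; exact: leq_trans h (vm i).
apply: (aP (p x)); last first.
  by exists (idx (p x)) => //; exact/subset_closure/idxP.
move=> i; rewrite !pP // -mulrBl normrM normfV (ger0_norm (ler0n _ _)).
rewrite ler_piMl ?invr_ge0 //.
have /andP[v1 v2] := xv i; rewrite -natrB // normr_nat lern1.
lia.
Qed.

Lemma cube_dimensions (R : realType) (n : nat) (Y : topologicalType)
    (g : 'I_n -> Y -> R) :
  hausdorff_space Y -> compact [set: Y] -> (forall i, continuous (g i)) ->
  (forall x y, (forall i, g i x = g i y) -> x = y) ->
  (forall i y, 0 <= g i y <= 1) ->
  (forall q : 'I_n -> R, (forall i, 0 <= q i <= 1) ->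
    exists y, forall i, g i y = q i) ->
  [/\ dimension_eq covering_dim_lt Y n, dimension_eq small_ind_lt Y n &
    dimension_eq large_ind_lt Y n].
Proof.
move=> hY cY cg sep g01 onto.
have nS := cube_not_shrinkable hY cY cg sep onto.
have small k : large_ind_lt k Y -> small_ind_lt k Y.
  exact: large_ind_small_ind.
have shr k : small_ind_lt k Y -> shrinkable k Y.
  exact: (small_ind_shrinkable R).
have L : large_ind_lt n.+1 Y.
  apply: (large_ind_lt_grid (f := g) (T := [::])) => // y.
  by rewrite ltn_addr.
split; split => //.
- exact/shrinkable_covering_dim/shr/small.
- by move=> /covering_dim_shrinkable.
- exact: small.
- by move=> /shr.
- by move=> /small/shr.
Qed.

(** * Remainders of Smirnov compactifications *)

Section smirnov_points.
Context {R : realType} {M : metricType R}.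

(** The extension to the cube of a bounded uniformly continuous function. *)
Definition smirnov_coord (u : bounded_unif_continuous M)
  (p : @smirnov_cube R M) : R := \val (p u).

Lemma smirnov_coord_continuous u : continuous (smirnov_coord u).
Proof.
move=> p; apply: continuous_comp.
  exact: (@proj_continuous _
    (fun f : bounded_unif_continuous M => range_hull (\val f)) u).
exact: set_val_continuous.
Qed.

Lemma smirnov_coord_eval u (x : M) :
  smirnov_coord u (smirnov_eval M x) = \val u x.
Proof. by []. Qed.

Lemma smirnov_coord_inj (p q : @smirnov_cube R M) :
  (forall u, smirnov_coord u p = smirnov_coord u q) -> p = q.
Proof.
by move=> pq; apply: functional_extensionality_dep => u; exact/val_inj/pq.
Qed.

Lemma smirnov_cube_hausdorff : hausdorff_space (@smirnov_cube R M).
Proof.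
apply: hausdorff_product => u; apply: hausdorff_set_type; exact: Rhausdorff.
Qed.

Lemma smirnov_cube_compact : compact [set: @smirnov_cube R M].
Proof.
have := @tychonoff _ (fun f : bounded_unif_continuous M => range_hull (\val f))
  (fun=> setT).
rewrite (_ : [set f | _] = setT); last by apply/seteqP; split.
by apply => u; apply: compact_set_type; exact: segment_compact.
Qed.

Lemma smirnov_coord_near u (p : @smirnov_cube R M) e : 0 < e ->
  nbhs p [set q | `|smirnov_coord u q - smirnov_coord u p| < e].
Proof.
move=> e0.
have /cvgrPdistC_lt : smirnov_coord u q @[q --> p] --> smirnov_coord u p.
  exact: smirnov_coord_continuous.
exact.
Qed.

(** A point of the compactification is approximated by points of the space,
    with respect to finitely many coordinates. *)
Lemma smirnov_approx (I : finType) (u : I -> bounded_unif_continuous M)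
    (p : @smirnov_cube R M) (e : R) : 0 < e -> smirnov_compactification M p ->
  exists x, forall i, `|\val (u i) x - smirnov_coord (u i) p| < e.
Proof.
move=> e0 Sp.
have Np : nbhs p [set q |
    forall i, `|smirnov_coord (u i) q - smirnov_coord (u i) p| < e].
  apply: (@filter_forall _ _ _ (nbhs p)) => i.
  exact: smirnov_coord_near.
by have [_ [[x _ <-] xe]] := Sp _ Np; exists x.
Qed.

End smirnov_points.

Lemma unif_continuous_continuous (R : realType) (M : metricType R)
    (f : M -> R) :
  unif_continuous f -> continuous f.
Proof.
move=> /unif_continuousP uf x; apply/cvgrPdist_lt => e e0.
have [d d0 df] := uf e e0.
by near=> y; apply: (df (x, y)) => /=; near: y; exact: nbhsx_ballx.
Unshelve. all: by end_near. Qed.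

(** If, outside of compact sets, the metric is controlled by finitely many
    uniformly continuous functions [f i] with values in [[0, 1]], which form a
    map to the cube that is dense at infinity, then the remainder is
    homeomorphic to the cube. Being at infinity is measured by the smallness of
    [h]. *)
Section cube_remainder.
Context {R : realType} {M : metricType R} (n : nat).
Variables (h : M -> R) (f : 'I_n -> M -> R).
Hypothesis uh : unif_continuous h.
Hypothesis h0 : forall x, 0 < h x.
Hypothesis h1 : forall x, h x <= 1.
Hypothesis hK : forall e, 0 < e -> compact [set x | e <= h x].
Hypothesis uf : forall i, unif_continuous (f i).
Hypothesis f01 : forall i x, 0 <= f i x <= 1.
Hypothesis fclose : forall e, 0 < e -> exists2 d, 0 < d &
  forall x y, h x < d -> h y < d -> (forall i, `|f i x - f i y| < d) ->
    ball x e y.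
Hypothesis fdense : forall (q : 'I_n -> R) e,
  (forall i, 0 <= q i <= 1) -> 0 < e ->
  exists2 x, h x < e & forall i, `|f i x - q i| < e.

Let bounded01 (g : M -> R) : (forall x, 0 <= g x <= 1) -> bounded_fun g.
Proof.
move=> g01; exists 1; split => // r r1 x _ /=.
by have /andP[g0 g1] := g01 x; rewrite ger0_norm // (le_trans g1) // ltW.
Qed.

Let h01 x : 0 <= h x <= 1. Proof. by rewrite ltW //= h1. Qed.

Let bh : bounded_unif_continuous M :=
  SigSub (mem_set (conj (bounded01 h01) uh)).

Let bf (i : 'I_n) : bounded_unif_continuous M :=
  SigSub (mem_set (conj (bounded01 (f01 i)) (uf i))).

(** A point of the compactification at which the extension of [h] is positive is
    a limit of points of a compact superlevel set of [h], hence belongs to the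
    space. *)
Lemma smirnov_coord_height_gt0 (p : @smirnov_cube R M) :
  smirnov_compactification M p -> 0 < smirnov_coord bh p ->
  range (smirnov_eval M) p.
Proof.
move=> Sp; set c := smirnov_coord bh p => c0.
have c20 : 0 < c / 2 by rewrite divr_gt0.
pose F := filter_from (nbhs p)
  (fun N => [set x | c / 2 <= h x /\ N (smirnov_eval M x)]).
have PF : ProperFilter F.
  apply: filter_from_proper; last first.
    move=> N Np; have [|_ [[x _ <-] [xN hx]]] :=
        Sp (N `&` [set q | `|smirnov_coord bh q - c| < c / 2]).
      apply: filterI => //.
      exact: smirnov_coord_near.
    exists x; split => //; move: hx; rewrite /= smirnov_coord_eval /= ltr_norml.
    by move=> /andP[? _]; lra.
  apply: filter_from_filter; first by exists setT; exact: filterT.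
  move=> N N' Np N'p; exists (N `&` N'); first exact: filterI.
  by move=> x [hx [Nx N'x]].
have FK : F [set x | c / 2 <= h x].
  by exists setT; [exact: filterT|move=> x []].
have [x0 [_ clx0]] := hK c20 PF FK.
exists x0 => //; apply: smirnov_coord_inj => u; rewrite smirnov_coord_eval.
apply/eqP; rewrite -subr_eq0 -normr_le0; apply/ler_addgt0Pl => e e0.
have e20 : 0 < e / 2 by rewrite divr_gt0.
have cu : continuous (\val u).
  by apply: unif_continuous_continuous; have [] := set_valP u.
have [||x [[_ /= ux] ux0]] := clx0
    [set x | c / 2 <= h x /\
      `|smirnov_coord u (smirnov_eval M x) - smirnov_coord u p| < e / 2]
    [set x | `|\val u x0 - \val u x| < e / 2].
- exists [set q | `|smirnov_coord u q - smirnov_coord u p| < e / 2] => //.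
  exact: smirnov_coord_near.
- exact: cvgr_dist_lt (cu x0) _ e20.
rewrite smirnov_coord_eval in ux.
apply: le_trans (ler_distD (\val u x) _ _) _.
by move: ux0 => /=; lra.
Qed.

Let smirnov_remainderE : smirnov_remainder M =
  smirnov_compactification M `&` [set p | smirnov_coord bh p <= 0].
Proof.
apply/seteqP; split => p [Sp hp]; split => //.
  by rewrite /= leNgt; apply/negP => hp0; exact/hp/smirnov_coord_height_gt0.
by move=> [x _ xp]; move: hp; rewrite /= -xp smirnov_coord_eval /= leNgt h0.
Qed.

Lemma closed_smirnov_remainder : closed (smirnov_remainder M).
Proof.
rewrite smirnov_remainderE; apply: closedI; first exact: closed_closure.
apply: (preimage_closed (f := smirnov_coord bh) (D := [set r | r <= 0])).
  by move=> p _; exact: smirnov_coord_continuous.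
exact: closed_le.
Qed.

Lemma smirnov_remainder_compact : compact [set: smirnov_remainder M].
Proof.
apply/compact_set_type/(subclosed_compact _ smirnov_cube_compact) => //.
exact: closed_smirnov_remainder.
Qed.

Lemma smirnov_remainder_hausdorff : hausdorff_space (smirnov_remainder M).
Proof. exact/hausdorff_set_type/smirnov_cube_hausdorff. Qed.

(** The extensions of the functions [f i] to the remainder. *)
Definition remainder_coord (i : 'I_n) (y : smirnov_remainder M) : R :=
  smirnov_coord (bf i) (set_val y).

Lemma remainder_coord_continuous i : continuous (remainder_coord i).
Proof.
move=> y; apply: continuous_comp; first exact: set_val_continuous.
exact: smirnov_coord_continuous.
Qed.

Let remainder_approx (u : bounded_unif_continuous M) (y : smirnov_remainder M)
    (e : R) : 0 < e -> exists x, [/\ h x < e,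
    forall i, `|f i x - remainder_coord i y| < e &
    `|\val u x - smirnov_coord u (set_val y)| < e].
Proof.
move=> e0; have := set_valP y; rewrite {1}smirnov_remainderE => -[Sy hy].
pose w (o : option (option 'I_n)) :=
  match o with None => u | Some None => bh | Some (Some i) => bf i end.
have [x xP] := smirnov_approx w e0 Sy.
exists x; split.
- have := xP (Some None); rewrite /= ltr_norml => /andP[_].
  by move: hy => /=; lra.
- by move=> i; exact: (xP (Some (Some i))).
- exact: (xP None).
Qed.

Lemma remainder_coord01 i y : 0 <= remainder_coord i y <= 1.
Proof.
apply/andP; split; apply/ler_addgt0Pl => e e0;
  have [x [_ /(_ i) + _]] := remainder_approx bh y e0;
  have /andP[] := f01 i x; rewrite ltr_norml => ? ? /andP[? ?]; lra.
Qed.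

(** A uniformly continuous function is determined by the [f i] at infinity. *)
Lemma remainder_coord_inj x y :
  (forall i, remainder_coord i x = remainder_coord i y) -> x = y.
Proof.
move=> xy; apply/val_inj/smirnov_coord_inj => u.
apply/eqP; rewrite -subr_eq0 -normr_le0; apply/ler_addgt0Pl => e e0.
have e30 : 0 < e / 3 by rewrite divr_gt0.
have [_ /unif_continuousP uu] := set_valP u.
have [d d0 du] := uu _ e30.
have [c c0 cd] := fclose d0.
pose r := Num.min (c / 2) (e / 3).
have r0 : 0 < r by rewrite lt_min e30 divr_gt0.
have [rc re] : r <= c / 2 /\ r <= e / 3.
  by split; rewrite ge_min lexx ?orbT.
have [a [ha fa ua]] := remainder_approx u x r0.
have [b [hb fb ub]] := remainder_approx u y r0.
have /du /= : ball (a, b).1 d (a, b).2.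
  apply: cd => [||i]; [lra|lra|].
  apply: le_lt_trans (ler_distD (remainder_coord i x) _ _) _.
  have := fa i; have := fb i; rewrite -xy (distrC _ (f i b)); lra.
rewrite /ball /= => uab.
have := ler_distD (\val u a) (smirnov_coord u (set_val x))
  (smirnov_coord u (set_val y)).
have := ler_distD (\val u b) (\val u a) (smirnov_coord u (set_val y)).
rewrite (distrC _ (\val u a)); lra.
Qed.

Lemma remainder_coord_onto (q : 'I_n -> R) : (forall i, 0 <= q i <= 1) ->
  exists y, forall i, remainder_coord i y = q i.
Proof.
move=> q01.
pose B (e : R) := [set smirnov_eval M x | x in
  [set x | h x < e /\ forall i, `|f i x - q i| < e]].
pose F := filter_from [set e | 0 < e] B.
have PF : ProperFilter F.
  apply: filter_from_proper; last first.
    move=> e e0; have [x hx fx] := fdense q01 e0.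
    by exists (smirnov_eval M x), x.
  apply: filter_from_filter; first by exists 1 => /=.
  move=> e e' /= e0 e'0; exists (Num.min e e'); first by rewrite /= lt_min e0.
  move=> _ [x [hx fx] <-]; move: hx; rewrite lt_min => /andP[hx hx'].
  by split; exists x => //; split => // i; have := fx i;
    rewrite lt_min => /andP[].
have [p [_ clp]] := smirnov_cube_compact PF (@filterT _ F _).
have approx (u : bounded_unif_continuous M) (e : R) : 0 < e ->
    exists x, [/\ h x < e, forall i, `|f i x - q i| < e &
      `|\val u x - smirnov_coord u p| < e].
  move=> e0; have [||_ [[x [hx fx] <-] xu]] :=
    clp (B e) [set p' | `|smirnov_coord u p' - smirnov_coord u p| < e].
  - by exists e.
  - exact: smirnov_coord_near.
  by exists x.
have Rp : smirnov_remainder M p.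
  rewrite smirnov_remainderE; split.
    move=> N Np; have [||_ [[x _ <-] xN]] := clp (B 1) N => //.
      by exists 1 => /=.
    by exists (smirnov_eval M x); split => //; exists x.
  apply/ler_addgt0Pl => e e0 /=; have e20 : 0 < e / 2 by rewrite divr_gt0.
  have [x [hx _]] := approx bh _ e20; rewrite /= ltr_norml => /andP[? ?]; lra.
exists (SigSub (mem_set Rp)) => i; rewrite /remainder_coord /=.
apply/eqP; rewrite -subr_eq0 -normr_le0; apply/ler_addgt0Pl => e e0.
have e20 : 0 < e / 2 by rewrite divr_gt0.
have [x [_ /(_ i) fq fp]] := approx (bf i) _ e20.
apply: le_trans (ler_distD (f i x) _ _) _; rewrite distrC.
move: fp => /=; lra.
Qed.

End cube_remainder.

(** * A function vanishing at infinity *)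

Section metric_balls.
Context {R : realType} (M : metricType R).

Lemma dist_ge0 (x y : M) : (0 : R) <= mdist x y.
Proof. exact: mdist_ge0. Qed.

Lemma dist_triangle (x y z : M) : (mdist x z : R) <= mdist x y + mdist y z.
Proof. exact: metric_triangle. Qed.

Lemma nbhs_mdistP (x : M) (P : set M) :
  nbhs x P <-> exists2 e : R, 0 < e & forall y, (mdist x y : R) < e -> P y.
Proof.
rewrite -filter_from_ballE; split=> -[e e0 eP]; exists e => //.
  by move=> y xy; apply: eP; rewrite ballEmdist.
by rewrite ballEmdist.
Qed.

Lemma lipschitz_continuous (g : M -> R) :
  (forall x y, g x <= g y + mdist x y) -> continuous g.
Proof.
move=> gL x; apply/cvgrPdist_lt => e e0; apply/nbhs_mdistP; exists e => // y xy.
rewrite ltr_norml; have := gL x y; have := gL y x; rewrite (metric_sym y x).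
by move=> ? ?; apply/andP; split; lra.
Qed.

Lemma closed_mdist_ball (x : M) (r : R) : closed [set y | (mdist x y : R) <= r].
Proof.
apply: (preimage_closed (f := mdist x) (D := [set s | s <= r])); last first.
  exact: closed_le.
move=> y _; apply: (@lipschitz_continuous (mdist x)) => a b.
by rewrite (metric_sym a b) dist_triangle.
Qed.

End metric_balls.

Section supremum.
Context {R : realType}.

Lemma sup_seq_ge (F : nat -> R) N :
  (forall k, F k <= 1) -> F N <= sup (range F).
Proof.
move=> F1; apply: ub_le_sup; last by exists N.
by exists 1 => _ [k _ <-].
Qed.

Lemma sup_seq_le (F : nat -> R) c : (forall k, F k <= c) -> sup (range F) <= c.
Proof.
move=> Fc; apply: ge_sup; first by exists (F 0%N), 0%N.
by move=> _ [k _ <-].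
Qed.

Lemma sup_seq_leD (F G : nat -> R) c : (forall k, G k <= 1) ->
  (forall k, F k <= G k + c) -> sup (range F) <= sup (range G) + c.
Proof.
move=> G1 FG; apply: sup_seq_le => k; apply: le_trans (FG k) _.
by rewrite lerD2r sup_seq_ge.
Qed.

End supremum.

(** A noncompact locally compact separable metric space carries a positive
    nonexpansive function with compact superlevel sets. It is the supremum of
    the functions [max 0 (r - mdist a x) / (N + 1)], where the [N]-th pair
    [(a, r)] consists of a point of a countable dense set and of a radius
    [r = 1 / (k + 1)] such that the closed ball is compact; the function is zero
    for the other pairs. *)
Lemma height_function (R : realType) (M : metricType R) :
  locally_compact [set: M] -> separable M -> ~ compact [set: M] ->
  exists h : M -> R, [/\ forall x, 0 < h x, forall x, h x <= 1,
    forall x y, h x <= h y + mdist x y &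
    forall e, 0 < e -> compact [set x | e <= h x]].
Proof.
move=> lcM [D /pcard_injP[F F_inj] dD] ncM.
have [x0 Dx0] : D !=set0.
  apply/set0P/eqP => D0; apply: ncM.
  rewrite (_ : setT = set0); first exact: compact0.
  rewrite -subset0 => x _; have [|//|y [_]] := dD setT; first by exists x.
    exact: openT.
  by rewrite D0.
have [s sD] : exists s : nat -> M, forall x (e : R), 0 < e ->
    exists a, (mdist (s a) x : R) < e.
  have /choice[s sP] N : exists y, forall z, D z -> F z = N -> y = z.
    have [[z [Dz Fz]]|nz] := pselect (exists z, D z /\ F z = N).
      by exists z => z' Dz' Fz'; apply: F_inj; rewrite ?inE // Fz Fz'.
    by exists x0 => z Dz Fz; case: nz; exists z.
  exists s => x e e0; have [||y [xy Dy]] := dD ((ball x e)°).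
  - by exists x; exact: nbhsx_ballx.
  - exact: open_interior.
  move/interior_subset in xy.
  exists (F y); rewrite (sP _ y Dy erefl) metric_sym.
  by rewrite ballEmdist in xy.
pose dec (N : nat) : nat * nat := odflt (0%N, 0%N) (unpickle N).
pose cball (a k : nat) := [set y | (mdist (s a) y : R) <= (k.+1%:R)^-1].
pose bump (N : nat) (x : M) : R := let: (a, k) := dec N in
  if `[< compact (cball a k) >] then
    Num.max 0 ((k.+1%:R)^-1 - mdist (s a) x) / N.+1%:R else 0.
have inv01 k : 0 < (k.+1%:R : R)^-1 <= 1.
  by rewrite invr_gt0 ltr0n /= invf_le1 ?ltr0n // ler1n.
have bump0 N x : 0 <= bump N x.
  rewrite /bump; case: (dec N) => a k; case: ifP => // _.
  by rewrite divr_ge0 // le_max lexx.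
have bumpN N x : bump N x <= (N.+1%:R)^-1.
  rewrite /bump; case: (dec N) => a k; case: ifP => _; last first.
    by case/andP: (inv01 N) => /ltW.
  rewrite ler_piMl ?invr_ge0 // ge_max ler01 /=.
  by have /andP[_] := inv01 k; have := dist_ge0 (s a) x; set t := _^-1; lra.
have bump1 N x : bump N x <= 1.
  by apply: le_trans (bumpN N x) _; have /andP[] := inv01 N.
have bumpL N x y : bump N x <= bump N y + mdist x y.
  rewrite /bump; case: (dec N) => a k; case: ifP => _; last first.
    by rewrite add0r mdist_ge0.
  have d0 := dist_ge0 x y.
  have tri := dist_triangle (s a) x y.
  apply: (@le_trans _ _
      ((Num.max 0 ((k.+1%:R)^-1 - mdist (s a) y) + mdist x y) / N.+1%:R)).
    rewrite ler_pM2r; last by case/andP: (inv01 N).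
    rewrite ge_max; apply/andP; split.
      by rewrite addr_ge0 // le_max lexx.
    rewrite -lerBlDr le_max; apply/orP; right; move: tri; set t := _^-1; lra.
  by rewrite mulrDl lerD2l ler_piMr //; case/andP: (inv01 N).
pose h x := sup (range (bump ^~ x)).
have hge N x : bump N x <= h x by apply: (@sup_seq_ge _ (bump ^~ x)).
have hL x y : h x <= h y + mdist x y by apply: sup_seq_leD.
exists h; split => //.
- move=> x; have [|V Vx [cV clV]] := lcM x; first by [].
  have {}Vx : nbhs x V.
    by apply: (@filterS _ (nbhs x) _ _ _ _ Vx) => y; apply.
  have /nbhs_mdistP[r r0 rV] := Vx.
  have r20 : 0 < r / 2 by rewrite divr_gt0.
  have [k kr] : exists k, (k.+1%:R)^-1 < r / 2.
    exact: filter_ex (near_infty_natSinv_lt (PosNum r20)).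
  have [a ax] := sD x _ (andP (inv01 k)).1.
  have cb : compact (cball a k).
    apply: (subclosed_compact _ cV); first exact: closed_mdist_ball.
    move=> y /= ay; apply: rV; apply: le_lt_trans (dist_triangle x (s a) y) _.
    move: ay kr ax; rewrite /cball /= (metric_sym x); set t := _^-1; lra.
  apply: lt_le_trans (hge (pickle (a, k)) x).
  by rewrite /bump /dec pickleK /= (asboolT cb) divr_gt0 // lt_max subr_gt0 ax
    orbT.
- by move=> x; apply: sup_seq_le => N.
(* Only the functions of index N < N0 can exceed e / 2, so that the superlevel
   set lies in a finite union of compact balls. *)
- move=> e e0; pose N0 := Num.bound (e / 2)^-1.
  pose good N := `[< compact (cball (dec N).1 (dec N).2) >].
  apply: (@subclosed_compact _ _
    (\big[setU/set0]_(N < N0 | good N) cball (dec N).1 (dec N).2)).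
  + apply: (preimage_closed (f := h) (D := [set r | e <= r])); last first.
      exact: closed_ge.
    by move=> x _; exact: lipschitz_continuous.
  + by apply: bigsetU_compact => N /asboolP.
  move=> x /= ex.
  have [N Nx] : exists N, e / 2 < bump N x.
    apply: contrapT => nN; have : h x <= e / 2.
      apply: sup_seq_le => N; rewrite leNgt; apply/negP => Nx.
      by apply: nN; exists N.
    lra.
  have NN0 : (N < N0)%N.
    have e20 : 0 < e / 2 by rewrite divr_gt0.
    have eN := lt_le_trans Nx (bumpN N x).
    have {}eN : e / 2 * N.+1%:R < 1 by rewrite -ltr_pdivlMr // div1r.
    rewrite -(ltr_nat R); apply: lt_trans (archi_boundP _); last first.
      by rewrite invr_ge0 ltW.
    rewrite -[X in _ < X]div1r ltr_pdivlMr // mulrC; apply: le_lt_trans eN.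
    by rewrite ler_pM2l // ler_nat.
  have gN : good N.
    move: Nx; rewrite /bump /good; case: (dec N) => a k /=.
    by case: ifP => // _ e20; lra.
  rewrite (bigD1 (Ordinal NN0)) //=; left; move: Nx gN.
  rewrite /bump /good; case: (dec N) => a k /= + ck; rewrite ck => eN.
  have : 0 < Num.max 0 (k.+1%:R^-1 - mdist (s a) x) / N.+1%:R.
    by apply: lt_trans eN; rewrite divr_gt0.
  rewrite pmulr_lgt0 ?invr_gt0 // lt_max ltxx /= subr_gt0 => /ltW.
  exact.
Qed.

(** * A map to the cube that is dense at infinity *)

(** A sequence in the unit cube that visits every open set infinitely often. *)
Lemma dense_sequence (R : realType) (n : nat) :
  exists q : nat -> 'I_n -> R, (forall k i, 0 <= q k i <= 1) /\
    forall (Q : 'I_n -> R) (e : R) (N : nat), (forall i, 0 <= Q i <= 1) ->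
      0 < e -> exists2 k, (N <= k)%N & forall i, `|q k i - Q i| < e.
Proof.
(* The index k = 2 ^ c * (2 * N + 1) is read as the code c of a rational
   vector; each code has unboundedly many indices. *)
pose r (k : nat) : {ffun 'I_n -> rat} := odflt [ffun=> 0] (unpickle (logn 2 k)).
pose q k i : R := Num.max 0 (Num.min 1 (ratr (r k i))).
exists q; split.
  by move=> k i; rewrite le_max lexx /= ge_max ler01 ge_min lexx.
move=> Q e N Q01 e0.
have /choice[w wP] (i : 'I_n) : exists w : rat, `|ratr w - Q i| < e.
  have [|w] := @rat_in_itvoo R (Q i - e) (Q i + e); first by lra.
  rewrite in_itv /= => /andP[w1 w2]; exists w.
  by rewrite ltr_norml; apply/andP; split; lra.
pose c := pickle [ffun i => w i].
exists (2 ^ c * (2 * N).+1)%N.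
  by rewrite (leq_trans _ (leq_pmull _ _)) ?expn_gt0 //; lia.
move=> i; rewrite /q /r lognM ?expn_gt0 // pfactorK // logn_coprime; last first.
  by rewrite coprime2n /= oddM.
rewrite addn0 /c pickleK /= ffunE.
have := wP i; have /andP[Q0 Q1] := Q01 i; rewrite !ltr_norml => /andP[].
set x := ratr _ => w1 w2.
by case: (leP 1 x) => x1; [case: (leP 0 1)|case: (leP 0 x)] => x0;
  apply/andP; split; lra.
Qed.

Section interpolation.
Context {R : realType} (t : nat -> R).
Hypothesis t0 : forall k, 0 < t k.
Hypothesis t2 : forall k, t k.+1 <= t k / 2.

Lemma halving_lt k l : (k < l)%N -> t l <= t k / 2.
Proof.
elim: l => // l IH; rewrite ltnS leq_eqVlt => /orP[/eqP -> //|kl].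
by have := IH kl; have := t2 l; have := t0 l; lra.
Qed.

Lemma halving_le_inv k : t 0%N <= 1 -> t k <= (k.+1%:R)^-1.
Proof.
move=> t01; elim: k => [|k IH]; first by rewrite invr1.
apply: le_trans (t2 k) _; rewrite -[leRHS]div1r ler_pdivlMr // -(natr1 k.+1).
have : t k * k.+1%:R <= 1 by rewrite -ler_pdivlMr // div1r.
have : (1 : R) <= k.+1%:R by rewrite ler1n.
have := t0 k; set K := k.+1%:R => tk0 K1 tK.
have : 0 <= t k * (K - 1) by apply: mulr_ge0; [exact: ltW|rewrite subr_ge0].
by rewrite mulrBr mulr1 => h; lra.
Qed.

(** A tent of height one at [t k], vanishing at the other terms. *)
Definition tent (k : nat) (s : R) : R := Num.max 0 (1 - 2 * `|s / t k - 1|).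

Lemma tent_ge0 k s : 0 <= tent k s. Proof. by rewrite le_max lexx. Qed.

Lemma tent_le1 k s : tent k s <= 1.
Proof. by rewrite ge_max ler01 /= gerBl mulr_ge0. Qed.

Lemma tent_eq1 k : tent k (t k) = 1.
Proof.
by rewrite /tent divff ?gt_eqF // subrr normr0 mulr0 subr0 max_r.
Qed.

Lemma tent_eq0 k l : k != l -> tent k (t l) = 0.
Proof.
move=> kl; apply/max_l; rewrite subr_le0.
have tk := t0 k; have tl := t0 l.
case: (ltngtP k l) kl => // kl _.
  have h := halving_lt kl.
  have : t l / t k <= 1 / 2 by rewrite ler_pdivrMr //; lra.
  by move=> h'; rewrite ler0_norm; lra.
have h := halving_lt kl.
have : 2 <= t l / t k by rewrite ler_pdivlMr //; lra.
by move=> h'; rewrite ger0_norm; lra.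
Qed.

(** The tents that do not vanish on the half-line from [a] have a common
    Lipschitz constant there, because [t k > 2 * a / 3]. *)
Lemma tent_lipschitz k (a s s' : R) : 0 < a -> a <= s -> a <= s' ->
  tent k s <= tent k s' + 3 / a * `|s - s'|.
Proof.
move=> a0 as_ as'; have tk := t0 k.
have D0 : 0 <= 3 / a * `|s - s'| by rewrite mulr_ge0 // divr_ge0 // ltW.
have [ta|ta] := leP (t k) (2 * a / 3).
  have -> : tent k s = 0.
    apply/max_l; have : 3 / 2 <= s / t k by rewrite ler_pdivlMr //; lra.
    by move=> h; rewrite ger0_norm; lra.
  by rewrite addr_ge0 // tent_ge0.
have : 2 * `|s / t k - s' / t k| <= 3 / a * `|s - s'|.
  rewrite -mulrBl normrM mulrCA mulrC ler_wpM2r //.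
  rewrite normfV gtr0_norm // ler_pdivlMr // mulrAC ler_pdivrMr //; lra.
have := ler_distD (s / t k) (s' / t k) 1.
rewrite (distrC (s' / t k) (s / t k)) => h1 h2.
rewrite ge_max addr_ge0 ?tent_ge0 //= -lerBlDr le_max; apply/orP; right.
lra.
Qed.

End interpolation.

(** A nonexpansive positive function with arbitrarily small values factors a
    continuous map to the cube under which the image of every sublevel set is
    dense. The points [x_ k] have rapidly decreasing values [t k], and tents
    around the [t k] interpolate a sequence of points of the cube that visits
    every open set infinitely often. *)
Lemma dense_map (R : realType) (M : metricType R) (n : nat) (h : M -> R) :
  (forall x, 0 < h x) -> (forall x y, h x <= h y + mdist x y) ->
  (forall e, 0 < e -> exists x, h x < e) ->
  exists f : 'I_n -> M -> R, [/\ forall i x, 0 <= f i x <= 1,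
    forall i, continuous (f i) &
    forall (q : 'I_n -> R) e, (forall i, 0 <= q i <= 1) -> 0 < e ->
      exists2 x, h x < e & forall i, `|f i x - q i| < e].
Proof.
move=> h0 hL hsmall.
have /choice[pick pickP] (e : R) : exists x, 0 < e -> h x < e.
  have [e0|e0] := ltP 0 e; first by have [x hx] := hsmall e e0; exists x.
  by have [x _] := hsmall 1 ltr01; exists x.
pose x_ := fix x_ k := if k is k'.+1 then pick (h (x_ k') / 2) else pick 1.
pose t k := h (x_ k).
have t0 k : 0 < t k by exact: h0.
have t2 k : t k.+1 <= t k / 2 by apply/ltW/pickP; rewrite divr_gt0.
have t01 : t 0%N <= 1 by apply/ltW/pickP.
have [q [q01 qdense]] := dense_sequence R n.
pose F i x k := tent t k (h x) * q k i.
have F1 i x k : F i x k <= 1.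
  have /andP[q0 q1] := q01 k i.
  by apply: le_trans q1; rewrite ler_piMl // tent_le1.
have F0 i x k : 0 <= F i x k.
  by have /andP[q0 q1] := q01 k i; rewrite mulr_ge0 // tent_ge0.
exists (fun i x => sup (range (F i x))); split.
- move=> i x; apply/andP; split; last exact: sup_seq_le.
  by apply: le_trans (sup_seq_ge 0 (F1 i x)).
- move=> i x; apply/cvgrPdist_lt => e e0; apply/nbhs_mdistP.
  pose a := h x / 2.
  have a0 : 0 < a by rewrite divr_gt0.
  have ae0 : 0 < a * e / 3 by rewrite divr_gt0 // mulr_gt0.
  exists (Num.min a (a * e / 3)); first by rewrite lt_min a0.
  move=> y; rewrite lt_min => /andP[xya xye].
  have hxy := hL x y; have := hL y x; rewrite (metric_sym y x) => hyx.
  have ax : a <= h x by rewrite /a; have := h0 x; lra.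
  have ay : a <= h y.
    by move: xya; rewrite /a => xya; lra.
  have hd : 3 / a * `|h x - h y| < e.
    have : `|h x - h y| < a * e / 3.
      by rewrite ltr_norml; apply/andP; split; lra.
    by move=> hh; rewrite mulrAC ltr_pdivrMr //; lra.
  have FL x1 x2 k : a <= h x1 -> a <= h x2 ->
      F i x1 k <= F i x2 k + 3 / a * `|h x1 - h x2|.
    move=> a1 a2; have /andP[q0 q1] := q01 k i.
    have H := tent_lipschitz t0 k a0 a1 a2.
    apply: le_trans (ler_wpM2r q0 H) _; rewrite mulrDl lerD2l ler_piMr //.
    by rewrite mulr_ge0 // divr_ge0 // ltW.
  have := sup_seq_leD (F1 i y) (fun k => FL x y k ax ay).
  have := sup_seq_leD (F1 i x) (fun k => FL y x k ay ax).
  rewrite (distrC (h y)) => s1 s2; rewrite ltr_norml; apply/andP; split; lra.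
move=> Q e Q01 e0.
have [N _ Ne] : exists2 N, True & forall k, (N <= k)%N -> (k.+1%:R)^-1 < e.
  have [N _ Ne] := near_infty_natSinv_lt (PosNum e0).
  by exists N => // k Nk; exact: Ne.
have [k Nk qk] := qdense Q e N Q01 e0.
exists (x_ k).
  by apply: le_lt_trans (halving_le_inv t0 t2 k t01) (Ne k Nk).
move=> i; suff -> : sup (range (F i (x_ k))) = q k i by exact: qk.
apply/eqP; rewrite eq_le; apply/andP; split.
  apply: sup_seq_le => l; rewrite /F -/(t k).
  have [->|lk] := eqVneq l k; first by rewrite tent_eq1 // mul1r.
  by rewrite tent_eq0 // mul0r; have /andP[] := q01 k i.
apply: le_trans (sup_seq_ge k (F1 i (x_ k))).
by rewrite /F -/(t k) tent_eq1 // mul1r.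
Qed.

(** * The metric *)

(** The metric built from [h] and [f]; the space [M] carries the given metric
    and [X] the new one. *)
Section collapsed_metric.
Context {R : realType} (M : metricType R) (n : nat).
Variables (h : M -> R) (f : 'I_n -> M -> R).
Hypothesis h0 : forall x, 0 < h x.
Hypothesis h1 : forall x, h x <= 1.
Hypothesis hL : forall x y, h x <= h y + mdist x y.
Hypothesis hK : forall e, 0 < e -> compact [set x | e <= h x].
Hypothesis f01 : forall i x, 0 <= f i x <= 1.
Hypothesis cf : forall i, continuous (f i).
Hypothesis fdense : forall (q : 'I_n -> R) e,
  (forall i, 0 <= q i <= 1) -> 0 < e ->
  exists2 x, h x < e & forall i, `|f i x - q i| < e.

(** The distance in the space obtained by adding a point at infinity at
    distance [h x] from [x], for [h] nonexpansive. *)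
Definition collapsed_dist (x y : M) : R := Num.min (mdist x y) (h x + h y).

(** The distance of the graph of [f] in the product of that space with the cube,
    where the cube carries the sum of the distances of the coordinates. *)
Definition graph_dist (x y : M) : R :=
  collapsed_dist x y + \sum_i `|f i x - f i y|.

Lemma collapsed_dist_ge0 x y : 0 <= collapsed_dist x y.
Proof. by rewrite le_min dist_ge0 addr_ge0 // ltW. Qed.

Lemma collapsed_dist_tri x y z :
  collapsed_dist x z <= collapsed_dist x y + collapsed_dist y z.
Proof.
rewrite /collapsed_dist.
have := dist_triangle x y z; have := hL x y; have := hL z y.
have := dist_ge0 x y; have := dist_ge0 y z; rewrite (metric_sym z y).
have := h0 x; have := h0 y; have := h0 z => *.
rewrite ge_min; case: (leP (mdist x y) (h x + h y)) => _;
  case: (leP (mdist y z) (h y + h z)) => _;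
  first (by apply/orP; left); by apply/orP; right; lra.
Qed.

Lemma fdist_ge0 x y : 0 <= \sum_i `|f i x - f i y|.
Proof. exact: sumr_ge0. Qed.

Lemma graph_dist_metric : is_metric graph_dist.
Proof.
split.
- move=> x y; split => [d0|->]; last first.
    rewrite /graph_dist /collapsed_dist mdistxx big1 => [|i _]; last first.
      by rewrite subrr normr0.
    by rewrite addr0; apply/min_l; rewrite addr_ge0 // ltW.
  have c0 : collapsed_dist x y <= 0.
    by rewrite -d0 lerDl fdist_ge0.
  move: c0; rewrite ge_min => /orP[xy|].
    by apply/eqP; rewrite -[_ == _]negbK -mdist_gt0 -leNgt.
  by have := h0 x; have := h0 y => *; exfalso; lra.
- move=> x y; rewrite /graph_dist /collapsed_dist metric_sym (addrC (h x)).
  by congr (_ + _); apply: eq_bigr => i _; rewrite distrC.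
move=> x y z; rewrite /graph_dist.
rewrite addrACA lerD // ?collapsed_dist_tri // -big_split /=.
by apply: ler_sum => i _; exact: ler_distD.
Qed.

Let X := metrized graph_dist_metric.

Lemma graph_mdistE (x y : X) : mdist x y = graph_dist x y.
Proof. by []. Qed.

Lemma fdist_le i x y : `|f i x - f i y| <= graph_dist x y.
Proof.
rewrite /graph_dist (bigD1 i) //= addrCA lerDl addr_ge0 ?collapsed_dist_ge0 //.
exact: sumr_ge0.
Qed.

Lemma hdist_le x y : `|h x - h y| <= graph_dist x y.
Proof.
apply: (@le_trans _ _ (collapsed_dist x y)); last by rewrite lerDl fdist_ge0.
rewrite le_min; have := hL x y; have := hL y x; rewrite (metric_sym y x).
have := h0 x; have := h0 y => *.
by apply/andP; split; rewrite ler_norml; apply/andP; split; lra.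
Qed.

(** Near infinity, the metric is controlled by [f]. *)
Lemma graph_dist_close e : 0 < e -> exists2 d, 0 < d & forall x y,
  h x < d -> h y < d -> (forall i, `|f i x - f i y| < d) -> graph_dist x y < e.
Proof.
move=> e0; pose d := e / (n.+3)%:R.
have d0 : 0 < d by rewrite divr_gt0.
exists d => // x y hx hy fxy.
have -> : e = (d + d) + n%:R * d + d.
  rewrite -[LHS](divfK (_ : n.+3%:R != 0)) ?pnatr_eq0 // -/d.
  by rewrite -!natr1; ring.
apply: (@le_lt_trans _ _ ((d + d) + n%:R * d)); last by rewrite ltrDl.
apply: lerD; first by rewrite ge_min; apply/orP; right; lra.
apply: (@le_trans _ _ (\sum_(i < n) d)).
  by apply: ler_sum => i _; exact: ltW.
by rewrite sumr_const card_ord mulr_natl.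
Qed.

Lemma graph_dist_nbhs (x : M) (P : set M) :
  @nbhs _ M x P <-> @nbhs _ X x P.
Proof.
rewrite nbhs_mdistP; split.
  move=> [e e0 eP]; apply/nbhs_mdistP; exists (Num.min e (h x)).
    by rewrite lt_min e0 h0.
  move=> y; rewrite lt_min => /andP[xe xh]; apply: eP.
  have min_lt (a b c s : R) : 0 <= s -> 0 < c -> Num.min a (b + c) + s < e ->
      Num.min a (b + c) + s < b -> a < e.
    by case: (leP a (b + c)) => _ *; lra.
  exact: (min_lt _ _ _ _ (fdist_ge0 x y) (h0 y) xe xh).
move=> /nbhs_mdistP[e e0 eP].
have e20 : 0 < e / 2 by rewrite divr_gt0.
have en0 : 0 < e / 2 / n.+1%:R by rewrite divr_gt0.
have : \forall y \near x, forall i, `|f i x - f i y| < e / 2 / n.+1%:R.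
  apply: filter_forall => i.
  have /cvgrPdist_lt fx : f i y @[y --> x] --> f i x by exact: cf.
  exact: fx.
move=> /nbhs_mdistP[r r0 rf]; exists (Num.min r (e / 2)).
  by rewrite lt_min r0.
move=> y; rewrite lt_min => /andP[/rf fxy xy]; apply: eP.
rewrite graph_mdistE /graph_dist [e]splitr.
apply: ltr_leD; first by rewrite gt_min xy.
apply: (@le_trans _ _ (\sum_(i < n) e / 2 / n.+1%:R)).
  by apply: ler_sum => i _; exact: ltW.
rewrite sumr_const card_ord -[leLHS]mulr_natr [leLHS]mulrAC ler_pdivrMr //.
by rewrite ler_pM2l // ler_nat.
Qed.

Lemma graph_dist_open (A : set M) : @open M A <-> @open X A.
Proof.
by rewrite !openE; split => oA x Ax; apply/graph_dist_nbhs; exact: oA.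
Qed.

Lemma graph_dist_compact (A : set M) : @compact M A -> @compact X A.
Proof.
move=> cA F PF FA; have [p [Ap clp]] := cA F PF FA.
by exists p; split => // B N FB /graph_dist_nbhs; exact: clp.
Qed.

Let uh : unif_continuous (h : X -> R).
Proof.
apply/unif_continuousP => e e0; exists e => // -[x y] /=.
rewrite !ballEmdist; exact: le_lt_trans (hdist_le x y).
Qed.

Let uf i : unif_continuous (f i : X -> R).
Proof.
apply/unif_continuousP => e e0; exists e => // -[x y] /=.
rewrite !ballEmdist; exact: le_lt_trans (fdist_le i x y).
Qed.

Lemma graph_dist_totally_bounded : totally_bounded X.
Proof.
move=> e e0; have [d d0 dP] := graph_dist_close e0.
have [s [_ sP]] := @compact_finite_subcover X [set x | d <= h x]
  (fun x => ball x e) (graph_dist_compact (hK d0))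
  (fun x _ => nbhsx_ballx x e e0).
(* The compact part {d <= h} is covered by finitely many balls; the rest is cut
   according to the cells of side d / 2 containing the values of f, and each
   nonempty piece is contained in the ball around any of its points. *)
pose m := Num.bound (2 / d).
have md : 1 < m%:R * (d / 2).
  have : 2 / d < m%:R by apply: archi_boundP; rewrite divr_ge0 // ltW.
  by rewrite ltr_pdivrMr // mulrA ltr_pdivlMr // mul1r.
pose cell (c : {ffun 'I_n -> 'I_m}) : set M :=
  grid_cell f 0 (d / 2) c `&` [set x | h x < d].
have /choice[rep repP] c : exists o : option M, forall x, cell c x ->
    exists2 y, o = Some y & cell c y.
  have [[y cy]|nc] := pselect (exists y, cell c y).
    by exists (Some y) => x _; exists y.
  by exists None => x cx; case: nc; exists x.
exists [set` s ++ pmap rep (enum {: {ffun 'I_n -> 'I_m}})].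
  exact: finite_seq.
move=> x _; have [hx|hx] := leP d (h x).
  by have [y ys yx] := sP x hx; exists y => //=; rewrite mem_cat ys.
have [||c cx] := @grid_cell_cover R M n m f 0 (d / 2) x.
- by rewrite divr_gt0.
- move=> i; rewrite add0r; have /andP[-> fx1] := f01 i x.
  exact: le_lt_trans md.
have [y rc [cy hy]] := repP c x (conj cx hx).
exists y.
  by rewrite /= mem_cat mem_pmap; apply/orP; right; apply/mapP; exists c;
    rewrite ?mem_enum.
rewrite ballEmdist; apply: dP => // i.
have := cx i; have := cy i; rewrite !add0r -!(natr1 (c i)) !mulrDl mul1r.
move=> /andP[? ?] /andP[? ?].
by rewrite ltr_norml; apply/andP; split; lra.
Qed.

Let fclose e : 0 < e -> exists2 d, 0 < d & forall x y : X,
  h x < d -> h y < d -> (forall i, `|f i x - f i y| < d) -> ball x e y.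
Proof.
move=> e0; have [d d0 dP] := graph_dist_close e0.
exists d => [//|x y hx hy fxy].
rewrite ballEmdist; exact: dP.
Qed.

Lemma graph_dist_remainder (Y := smirnov_remainder X) :
  [/\ hausdorff_space Y, compact [set: Y] &
    exists g : 'I_n -> Y -> R, [/\ forall i, continuous (g i),
      forall x y, (forall i, g i x = g i y) -> x = y,
      forall i y, 0 <= g i y <= 1 &
      forall q : 'I_n -> R, (forall i, 0 <= q i <= 1) ->
        exists y, forall i, g i y = q i]].
Proof.
have hK' e : 0 < e -> @compact X [set x | e <= h x].
  by move=> e0; exact/graph_dist_compact/hK.
split.
- exact: smirnov_remainder_hausdorff.
- exact: (smirnov_remainder_compact uh h0 h1 hK').
exists (@remainder_coord R X n f uf f01); split.
- exact: remainder_coord_continuous.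
- exact: (remainder_coord_inj uh h0 h1 hK' fclose).
- exact: (remainder_coord01 uh h0 h1 hK').
- move=> q q01.
  have := @remainder_coord_onto R X n h f uh h0 h1 hK' uf f01 fdense q q01.
  exact.
Qed.

End collapsed_metric.

Theorem proposition3p1 (R : realType) (X : topologicalType)
  (noncompactX : ~ compact [set: X])
  (locally_compactX : locally_compact [set: X])
  (separableX : separable X)
  (metrizableX : metrizable R X) :
  forall n : nat, exists (d : X -> X -> R) (dm : is_metric d),
    [/\ compatible_metric dm,
        totally_bounded (metrized dm),
        dimension_eq covering_dim_lt (smirnov_remainder (metrized dm)) n,
        dimension_eq small_ind_lt (smirnov_remainder (metrized dm)) n &
        dimension_eq large_ind_lt (smirnov_remainder (metrized dm)) n].
Proof.
move=> n; have [rho [rm rhoX]] := metrizableX.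
pose M := metrized rm.
have nbhsM (x : X) (P : set X) : @nbhs _ X x P <-> @nbhs _ M x P.
  by rewrite (@nbhsE X) (@nbhsE M); split => -[U [oU Ux] UP]; exists U => //;
    split => //; exact/rhoX.
have compactM (A : set X) : @compact X A <-> @compact M A.
  by split=> cA F PF FA; have [p [Ap clp]] := cA F PF FA; exists p; split => //
    B N FB /nbhsM; exact: clp.
have closedM (A : set X) : @closed X A <-> @closed M A.
  by rewrite -(@openC X) -(@openC M); exact: rhoX.
have lcM : locally_compact [set: M].
  move=> x _; have [V Vx [cV clV]] := locally_compactX x I.
  exists V; first exact/nbhsM.
  by split; [exact/compactM|exact/closedM].
have sM : separable M.
  have [D cD dD] := separableX; exists D => // U U0 oU.
  by apply: dD => //; exact/rhoX.
have ncM : ~ compact [set: M] by move=> /compactM.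
have [h [h0 h1 hL hK]] := height_function lcM sM ncM.
have hsmall e : 0 < e -> exists x, h x < e.
  move=> e0; apply: contrapT => nx; apply: ncM.
  rewrite (_ : setT = [set x | e <= h x]); first exact: hK.
  apply/seteqP; split => // x _ /=; rewrite leNgt; apply/negP => hx.
  by apply: nx; exists x.
have [f [f01 cf fdense]] := dense_map n h0 hL hsmall.
exists (graph_dist h f), (graph_dist_metric f h0 hL).
have [hY cY [g [cg sep g01 onto]]] :=
  graph_dist_remainder h0 h1 hL hK f01 cf fdense.
have [dY iY IY] := cube_dimensions hY cY cg sep g01 onto.
split => //.
  by move=> A; rewrite rhoX; exact: graph_dist_open.
exact: (graph_dist_totally_bounded h0 hL hK f01 cf).
Qed.
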